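(* Let $p\in(0,1]$ and let $\Gamma$ be a set. The space $\ell_p(\Gamma)$ is a projective object in the category of $p$-Banach lattices and lattice homomorphisms if, and only if, the set $\Gamma$ is countable.
   Context: All spaces are real. A $p$-Banach lattice is a vector lattice complete for a $p$-norm (definite, homogeneous, $\|x+y\|^p\le\|x\|^p+\|y\|^p$) with $|x|\le|y|\Rightarrow\|x\|\le\|y\|$; lattice homomorphisms are linear, continuous and preserve finite suprema and infima. $\ell_p(\Gamma)$ carries its usual $p$-norm and coordinatewise order. A lattice quotient $\pi:X\to Z$ is a surjective lattice homomorphism such that the norm of $Z$ is the quotient norm, i.e. $\|z\|=\inf\{\|x\|:\pi(x)=z\}$. For $\lambda\ge1$, a $p$-Banach lattice $P$ is $\lambda$-projective if for every lattice quotient $\pi:X\to Z$ between $p$-Banach lattices and every lattice homomorphism $T:P\to Z$ there is a lattice homomorphism $\widetilde T:P\to X$ with $\pi\widetilde T=T$ and $\|\widetilde T\|\le\lambda\|T\|$. $P$ is projective if it is $\lambda$-projective for some $\lambda\ge1$. *)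

(* Defs.v *)
From HB Require Import structures.
From mathcomp Require Import all_boot all_order all_algebra.
From mathcomp Require Import all_classical all_reals all_analysis.
Set Implicit Arguments.
Unset Strict Implicit.
Unset Printing Implicit Defensive.
Import Order.TTheory GRing.Theory Num.Theory.
Import numFieldNormedType.Exports.
Local Open Scope classical_set_scope.
Local Open Scope ring_scope.

(* Hierarchy Builder rejects a join of [GRing.Lmodule] and [Order.Lattice]
   (missing joins below [Num.RealDomain]), so suprema and infima are added to
   [porderZmodType], with the axioms [lexI] and [leUx] of [Order.Lattice]. *)
HB.mixin Record isVectorLattice (R : realType) V
    of GRing.Lmodule R V & Num.POrderedZmodule V := {
  vmeet : V -> V -> V;
  vjoin : V -> V -> V;
  vlexI : forall x y z : V, (x <= vmeet y z) = (x <= y) && (x <= z);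
  vleUx : forall x y z : V, (vjoin x y <= z) = (x <= z) && (y <= z);
  vlerD2r : forall x y z : V, x <= y -> x + z <= y + z;
  vscaler_ge0 : forall (a : R) (x : V), 0 <= a -> 0 <= x -> 0 <= a *: x
}.

#[short(type="vectorLatticeType")]
HB.structure Definition VectorLattice (R : realType) :=
  {V of isVectorLattice R V & GRing.Lmodule R V & Num.POrderedZmodule V}.

Definition vabs (R : realType) (V : vectorLatticeType R) (x : V) : V :=
  vjoin x (- x).

HB.mixin Record isPBanachLattice (R : realType) (p : R) V
    of VectorLattice R V := {
  pnorm : V -> R;
  pnorm_ge0 : forall x, 0 <= pnorm x;
  pnorm0_eq0 : forall x, pnorm x = 0 -> x = 0;
  pnormZ : forall (a : R) x, pnorm (a *: x) = `|a| * pnorm x;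
  pnorm_powRD : forall x y,
    pnorm (x + y) `^ p <= pnorm x `^ p + pnorm y `^ p;
  le_pnorm : forall x y, vabs x <= vabs y -> pnorm x <= pnorm y;
  pnorm_complete : forall u : nat -> V,
    (forall e : R, 0 < e -> exists N : nat, forall m n : nat,
       (N <= m)%N -> (N <= n)%N -> pnorm (u m - u n) < e) ->
    exists l : V, pnorm (u n - l) @[n --> \oo] --> (0 : R)
}.

#[short(type="pBanachLatticeType")]
HB.structure Definition PBanachLattice (R : realType) (p : R) :=
  {V of isPBanachLattice R p V & VectorLattice R V}.

Section projectivity.
Variables (R : realType) (p : R).
Implicit Types X Z P : pBanachLatticeType p.

Definition pnorm_continuous X Z (f : X -> Z) : Prop :=
  forall (x : X) (e : R), 0 < e -> exists2 d : R, 0 < d &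
    forall y : X, pnorm (y - x) < d -> pnorm (f y - f x) < e.

Definition lattice_hom X Z (f : X -> Z) : Prop :=
  [/\ linear f, pnorm_continuous f,
      {morph f : x y / vmeet x y} & {morph f : x y / vjoin x y}].

Definition opnorm X Z (f : X -> Z) : R :=
  sup [set pnorm (f x) | x in [set x : X | pnorm x <= 1]].

Definition lattice_quotient X Z (f : X -> Z) : Prop :=
  [/\ lattice_hom f, set_surj setT setT f &
      forall z : Z, pnorm z = inf [set pnorm x | x in f @^-1` [set z]]].

Definition lambda_projective (lambda : R) P : Prop :=
  forall X Z (pi : X -> Z) (T : P -> Z),
    lattice_quotient pi -> lattice_hom T ->
    exists S : P -> X,
      [/\ lattice_hom S, pi \o S = T & opnorm S <= lambda * opnorm T].

Definition projective P : Prop :=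
  exists2 lambda : R, 1 <= lambda & lambda_projective lambda P.

End projectivity.

Section powR_subadditive.
Variables (R : realType) (p : R).
Hypothesis hp : 0 < p <= 1.

Lemma powR_sub (a b : R) : 0 <= a -> 0 <= b -> (a + b) `^ p <= a `^ p + b `^ p.
Proof.
have /andP[p0 p1] := hp.
move=> a0 b0; have [s0|] := ltP 0 (a + b); last first.
  move=> ab; have -> : a + b = 0 by apply/eqP; rewrite eq_le ab addr_ge0.
  rewrite powR0 ?gt_eqF//; apply: addr_ge0; exact: powR_ge0.
have key c : 0 <= c -> c <= a + b -> c / (a + b) * (a + b) `^ p <= c `^ p.
  move=> c0 cs; have [->|cn0] := eqVneq c 0; first by rewrite !mul0r powR_ge0.
  have cp : 0 < c by rewrite lt_neqAle eq_sym cn0.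
  rewrite -[in leRHS](divfK (lt0r_neq0 s0) c) powRM ?divr_ge0 ?(ltW s0)//.
  rewrite ler_wpM2r ?powR_ge0//.
  by apply: ger1_powR => //; rewrite divr_gt0//= ler_pdivrMr// mul1r.
have := lerD (key a a0 _) (key b b0 _).
rewrite lerDl lerDr b0 a0 -!mulrDl divff ?gt_eqF// mul1r; exact.
Qed.

End powR_subadditive.

Section ellp_pred.
Variables (R : realType) (p : R) (hp : 0 < p <= 1) (Gamma : choiceType).
Implicit Types f g : Gamma -> R.

Definition psum f : \bar R := \esum_(i in [set: Gamma]) (`|f i| `^ p)%:E.

Definition ellp_pred of 0 < p <= 1 : pred (Gamma -> R) :=
  fun f => (psum f < +oo)%E.
Local Notation S := (ellp_pred hp).

Let p0 : 0 < p. Proof. by have /andP[] := hp. Qed.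

Lemma psum_ge0 f : (0 <= psum f)%E.
Proof. by apply: esum_ge0 => i _; rewrite lee_fin powR_ge0. Qed.

Lemma psum_le f g : (forall i, `|f i| <= `|g i|) -> (psum f <= psum g)%E.
Proof.
move=> fg; apply: le_esum => i _; rewrite lee_fin.
by apply: ge0_ler_powR; rewrite ?nnegrE// ltW.
Qed.

Lemma psumD f g : (psum (f + g)%R <= psum f + psum g)%E.
Proof.
rewrite -esumD; [|by move=> i _; rewrite lee_fin powR_ge0..].
apply: le_esum => i _; rewrite -EFinD lee_fin.
apply: le_trans (powR_sub hp (normr_ge0 _) (normr_ge0 _)).
by apply: ge0_ler_powR; rewrite ?nnegrE ?addr_ge0 ?ler_normD// ltW.
Qed.

Lemma psum0 : psum 0 = 0%E.
Proof. by apply: esum1 => i _; rewrite normr0 powR0// gt_eqF. Qed.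

Lemma psum_ge_term f i : ((`|f i| `^ p)%:E <= psum f)%E.
Proof.
apply: esum_ge; exists [set i]; last by rewrite fsbig_set1.
by split => //; exact: finite_set1.
Qed.

Lemma psumZ a f : psum (a *: f) = ((`|a| `^ p)%:E * psum f)%E.
Proof.
have le b h : (psum (b *: h)%R <= (`|b| `^ p)%:E * psum h)%E.
  apply: ge_ereal_sup => _ [A [finA _] <-].
  rewrite (eq_fsbigr (fun i => (`|b| `^ p)%:E * (`|h i| `^ p)%:E)%E); last first.
    by move=> i _; rewrite normrM powRM.
  rewrite fsbig_finite//= -ge0_sume_distrr; last first.
    by move=> i _; rewrite lee_fin powR_ge0.
  rewrite lee_wpmul2l ?lee_fin ?powR_ge0// -fsbig_finite//.
  by apply: esum_ge; exists A.
apply/eqP; rewrite eq_le le /=; have [->|a0] := eqVneq a 0.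
  by rewrite normr0 powR0 ?gt_eqF// mul0e psum_ge0.
rewrite -[in leLHS](scalerK a0 f).
have ap : 0 < `|a| `^ p by rewrite powR_gt0 ?normr_gt0.
apply: le_trans (lee_wpmul2l _ (le a^-1 (a *: f))) _.
  by rewrite lee_fin ltW.
by rewrite muleA -EFinM -powRM// -normrM divff// normr1 powR1 mul1e.
Qed.

Lemma ellp_submod : submod_closed S.
Proof.
split; first by rewrite unfold_in psum0.
move=> a f g; rewrite !unfold_in => hf hg.
apply: le_lt_trans (psumD _ _) _; rewrite psumZ lte_add_pinfty//.
by rewrite lte_mul_pinfty ?lee_fin ?powR_ge0.
Qed.

Lemma ellp_meet_join (f g : Gamma -> R) : S f -> S g ->
  S (Order.meet f g) /\ S (Order.join f g).
Proof.
rewrite /ellp_pred => hf hg.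
pose h : Gamma -> R := fun i => `|f i| + `|g i|.
have hh : (psum h < +oo)%E.
  have e (k : Gamma -> R) : psum (fun i => `|k i|) = psum k.
    by apply: eq_esum => i _; rewrite normr_id.
  apply: le_lt_trans (psumD (fun i => `|f i|) (fun i => `|g i|)) _.
  by rewrite !e lte_add_pinfty.
split; apply: le_lt_trans hh; apply: psum_le => i;
  rewrite /h [leRHS]ger0_norm ?addr_ge0//.
- by rewrite meetfE meetEtotal /Order.min; case: ifP => _; rewrite ?lerDl ?lerDr.
- by rewrite joinfE joinEtotal /Order.max; case: ifP => _; rewrite ?lerDl ?lerDr.
Qed.

End ellp_pred.

(* The proof [hp] is an argument of the type [ellp hp Gamma] because the
   instances below need it. *)
Record ellp (R : realType) (p : R) (hp : 0 < p <= 1) (Gamma : choiceType) :=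
  Ellp { ellp_fun :> Gamma -> R; _ : ellp_pred hp ellp_fun }.

Section ellp_instances.
Variables (R : realType) (p : R) (hp : 0 < p <= 1) (Gamma : choiceType).
Local Notation S := (@ellp_pred R p Gamma hp).
Local Notation L := (ellp hp Gamma).

Let p0 : 0 < p. Proof. by have /andP[] := hp. Qed.

HB.instance Definition _ := [isSub for @ellp_fun R p hp Gamma].
HB.instance Definition _ := [Choice of L by <:].
HB.instance Definition _ := GRing.isSubmodClosed.Build R (Gamma -> R) S
  (ellp_submod hp Gamma).
HB.instance Definition _ := [SubChoice_isSubLmodule of L by <:].

HB.instance Definition _ := Order.SubChoice_isSubPOrder.Build _ (Gamma -> R) S
  ring_display L.

Definition ellp_meet (f g : L) : L :=
  Ellp (ellp_meet_join (valP f) (valP g)).1.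
Definition ellp_join (f g : L) : L :=
  Ellp (ellp_meet_join (valP f) (valP g)).2.

Lemma ellp_leP (f g : L) : reflect (forall i, f i <= g i) (f <= g).
Proof. by rewrite -Order.le_val; apply: (iffP (lefP _ _)). Qed.

Fact ellp_lexI (f g h : L) : (f <= ellp_meet g h) = (f <= g) && (f <= h).
Proof. by rewrite -!Order.le_val lexI. Qed.
Fact ellp_leUx (f g h : L) : (ellp_join f g <= h) = (f <= h) && (g <= h).
Proof. by rewrite -!Order.le_val leUx. Qed.
Fact ellp_lerD2r (f g h : L) : f <= g -> f + h <= g + h.
Proof.
by move=> /ellp_leP fg; apply/ellp_leP => i; exact: lerD (fg i) (lexx (h i)).
Qed.
Fact ellp_scaler_ge0 (a : R) (f : L) : 0 <= a -> 0 <= f -> 0 <= a *: f.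
Proof.
by move=> a0 /ellp_leP f0; apply/ellp_leP => i; exact: mulr_ge0 a0 (f0 i).
Qed.
HB.instance Definition _ := isVectorLattice.Build R L
  ellp_lexI ellp_leUx ellp_lerD2r ellp_scaler_ge0.

Definition ellp_norm (f : L) : R := fine (psum p f) `^ p^-1.

Lemma psum_fin (f : L) : psum p f \is a fin_num.
Proof. by rewrite ge0_fin_numE ?psum_ge0//; exact: valP f. Qed.
#[local] Hint Resolve psum_fin : core.

Lemma ellp_norm_powR (f : L) : ellp_norm f `^ p = fine (psum p f).
Proof.
by rewrite /ellp_norm -powRrM mulVf ?gt_eqF// powRr1// fine_ge0 ?psum_ge0.
Qed.

Lemma psum_le_ellp_norm (f g : L) : (psum p f <= psum p g)%E ->
  ellp_norm f <= ellp_norm g.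
Proof.
move=> fg; apply: ge0_ler_powR; rewrite ?nnegrE ?fine_ge0 ?psum_ge0//.
  by rewrite invr_ge0 ltW.
exact: fine_le.
Qed.

Fact ellp_norm_ge0 f : 0 <= ellp_norm f.
Proof. exact: powR_ge0. Qed.

Fact ellp_norm_eq0 f : ellp_norm f = 0 -> f = 0.
Proof.
move=> /(congr1 (fun x : R => x `^ p)).
rewrite ellp_norm_powR powR0 ?gt_eqF// => f0.
apply/val_inj/funext => i /=.
have := psum_ge_term p f i; rewrite -(fineK (psum_fin f)) f0 lee_fin => fi.
have : `|f i| `^ p = 0 by apply/eqP; rewrite eq_le fi powR_ge0.
by move=> /powR_eq0_eq0/normr0_eq0.
Qed.

Fact ellp_normZ (a : R) f : ellp_norm (a *: f) = `|a| * ellp_norm f.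
Proof.
rewrite /ellp_norm [psum _ _](psumZ hp) fineM ?psum_fin//.
rewrite powRM ?powR_ge0 ?fine_ge0 ?psum_ge0//.
by rewrite -powRrM mulfV ?gt_eqF// powRr1.
Qed.

Fact ellp_norm_powRD f g :
  ellp_norm (f + g) `^ p <= ellp_norm f `^ p + ellp_norm g `^ p.
Proof.
have := psumD hp f g; rewrite -(fineK (psum_fin f)) -(fineK (psum_fin g)).
rewrite -(fineK (psum_fin (f + g))) -EFinD lee_fin.
by rewrite -!ellp_norm_powR.
Qed.

Lemma ellp_vabsE (f : L) i : vabs f i = `|f i|.
Proof.
rewrite -maxrN -joinEtotal; exact: joinfE.
Qed.

Fact ellp_le_norm f g : vabs f <= vabs g -> ellp_norm f <= ellp_norm g.
Proof.
move=> /ellp_leP fg; apply: psum_le_ellp_norm; apply: (psum_le hp) => i.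
by have := fg i; rewrite !ellp_vabsE.
Qed.

Fact ellp_complete (u : nat -> L) :
  (forall e : R, 0 < e -> exists N : nat, forall m n : nat,
     (N <= m)%N -> (N <= n)%N -> ellp_norm (u m - u n) < e) ->
  exists l : L, ellp_norm (u n - l) @[n --> \oo] --> (0 : R).
Proof.
move=> uC.
have term (f : L) i : `|f i| <= ellp_norm f.
  have := psum_ge_term p f i; rewrite -(fineK (psum_fin f)) lee_fin.
  rewrite -ellp_norm_powR => h.
  rewrite -[leLHS]powRr1// -[leRHS]powRr1 ?powR_ge0//.
  rewrite -(mulfV (lt0r_neq0 p0)) !powRrM.
  by apply: ge0_ler_powR => //; rewrite ?nnegrE ?powR_ge0// invr_ge0 ltW.
have cv i : cvgn (fun n => u n i).
  apply: cauchy_cvg; apply/cauchy_exP => e e0; have [N uN] := uC _ e0.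
  exists (u N i); exists N => // n /= Nn; rewrite /ball/=.
  apply: le_lt_trans (term (u N - u n) i) _.
  exact: uN.
pose l : Gamma -> R := fun i => limn (fun n => u n i).
have key (e : R) : 0 < e -> exists N : nat, forall n, (N <= n)%N ->
    (psum p (val (u n) - l)%R <= e%:E)%E.
  move=> e0.
  have e20 : 0 < (e / 2) `^ p^-1 by rewrite powR_gt0// divr_gt0.
  have [N uN] := uC _ e20; exists N => n Nn.
  apply: ge_ereal_sup => _ [A [finA _] <-].
  rewrite fsbig_finite//= sumEFin lee_fin.
  set s := (X in \sum_(i <- X) _).
  have : \forall m \near \oo, \sum_(i <- s) `|u m i - l i| `^ p < e / 2.
    have : (\sum_(i <- s) `|u m i - l i| `^ p) @[m --> \oo] -->
        \sum_(i <- s) (0 : R).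
      apply: cvg_big => [|i _]; first exact: add_continuous.
      apply/cvgr0Pnorm_lt => d d0.
      have := cv i => /cvgrPdist_lt/(_ (d `^ p^-1)).
      rewrite powR_gt0// => /(_ isT); apply: filterS => m.
      rewrite distrC => h; rewrite [ltLHS]ger0_norm ?powR_ge0//.
      have -> : d = (d `^ p^-1) `^ p.
        by rewrite -powRrM mulVf ?gt_eqF// powRr1// ltW.
      by apply: gt0_ltr_powR; rewrite ?nnegrE ?powR_ge0.
    rewrite big1_eq => /cvgr0Pnorm_lt/(_ (e / 2)); rewrite divr_gt0// => /(_ isT).
    by apply: filterS => m; apply: le_lt_trans; exact: ler_norm.
  move=> [M _ hM].
  pose m := maxn N M.
  have lm := hM m (leq_maxr _ _).
  have : \sum_(i <- s) `|u n i - u m i| `^ p <= e / 2.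
    have un := uN n m Nn (leq_maxl _ _).
    have : ellp_norm (u n - u m) `^ p <= e / 2.
      have -> : e / 2 = ((e / 2) `^ p^-1) `^ p.
        by rewrite -powRrM mulVf ?gt_eqF// powRr1 ?divr_ge0// ltW.
      apply: ge0_ler_powR; rewrite ?nnegrE ?powR_ge0 ?ellp_norm_ge0//.
        exact: ltW.
      exact: ltW.
    apply: le_trans; rewrite ellp_norm_powR -lee_fin fineK//.
    rewrite -sumEFin; apply: esum_ge; exists A => //.
    by rewrite fsbig_finite.
  move=> um; rewrite [e]splitr; apply: le_trans (lerD um (ltW lm)).
  rewrite -big_split/=; apply: ler_sum => i _.
  apply: le_trans (powR_sub hp (normr_ge0 _) (normr_ge0 _)).
  apply: ge0_ler_powR; rewrite ?nnegrE ?addr_ge0//; first exact: ltW.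
  have -> : (val (u n) - l) i = (u n i - u m i) + (u m i - l i).
    by rewrite addrA subrK.
  exact: ler_normD.
have Sl : S l.
  have [N /(_ N (leqnn _)) h] := key _ ltr01.
  have -> : l = val (u N) - (val (u N) - l) by rewrite opprB addrC subrK.
  apply: rpredB; first exact: valP.
  by rewrite unfold_in; apply: le_lt_trans h _; rewrite ltry.
exists (Ellp Sl); apply/cvgr0Pnorm_le => e e0.
have [N hN] := key _ (powR_gt0 p e0).
near=> n; rewrite ger0_norm ?powR_ge0//.
rewrite -[leRHS]powRr1 ?(ltW e0)// -(mulfV (lt0r_neq0 p0)) powRrM.
apply: ge0_ler_powR; rewrite ?nnegrE ?powR_ge0 ?fine_ge0 ?psum_ge0//.
  by rewrite invr_ge0 ltW.
rewrite -lee_fin fineK//; apply: hN.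
by near: n; exact: nbhs_infty_ge.
Unshelve. all: by end_near. Qed.

HB.instance Definition _ := isPBanachLattice.Build R p L
  ellp_norm_ge0 ellp_norm_eq0 ellp_normZ ellp_norm_powRD ellp_le_norm
  ellp_complete.

End ellp_instances.

(* Main.v *)
Require Import Defs.
From HB Require Import structures.
From mathcomp Require Import all_boot all_order all_algebra.
From mathcomp Require Import all_classical all_reals all_analysis.
From mathcomp Require Import finmap lra.
Import Order.TTheory GRing.Theory Num.Theory.
Import numFieldNormedType.Exports.
Local Open Scope classical_set_scope.
Local Open Scope ring_scope.

Set Implicit Arguments.
Unset Strict Implicit.
Unset Printing Implicit Defensive.

(** A lattice homomorphism defined on l_p(Gamma) is the same thing as a bounded
    family of pairwise disjoint positive vectors, the images of the unit
    vectors [delta g]; so the question is whether such families lift along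
    lattice quotients.

    If Gamma is countable they do.  Lift the vectors [T (delta g)] one by one to
    positive vectors [y g], with norms bounded by [2 * opnorm T], and let [S0]
    be the bounded linear map with [S0 (delta g) = y g]; it lifts T and is
    positive, but the [y g] need not be disjoint.  Countability provides a
    strictly positive [w] in l_p(Gamma), with coordinates [eps g].  In
    l_p(Gamma) each unit vector is recovered from [w] by
    [(2 eps_g delta_g - w)^+ = eps_g delta_g] ([weak_unit_vpos]).  Copy this
    formula in X: the vectors
    [x g = eps_g^-1 (2 eps_g y_g - S0 w)^+] are still lifts of [T (delta g)],
    they lie between 0 and [y g], and they are pairwise disjoint because
    [eps_g y_g + eps_h y_h <= S0 w] ([vmeet_vpos_sub]).  The linear map sending
    [delta g] to [x g] is the required lift ([ellp_lambda_projective]).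

    Conversely, let alpha be the one-point compactification of the discrete
    set Gamma.  The inclusion of l_p(Gamma) in C(alpha) is a lattice
    homomorphism.  Add to alpha the pairs of elements of Gamma, with the
    convergences of (g, h) to g as h leaves every finite set, and to h as g
    does; C(alpha) is a quotient, by restriction, of the lattice of bounded
    functions that respect these convergences.  A lift of the inclusion yields
    pairwise disjoint functions [f g] with value 1 at g.  Continuity gives
    finite sets [J g] such that [f g > 0] at (g, d) and at (d, g) for all d
    outside [J g]; evaluating the disjoint functions [f g] and [f h] at (g, h) shows that [h] is in [J g] or
    [g] is in [J h].  Only a countable set carries such a map J into its finite
    subsets ([countable_finite_set_map]).  All these spaces have sup norms,
    which are p-norms for every p in (0, 1]. *)

(** * Vector lattices *)

Section vector_lattice.
Variables (R : realType) (V : vectorLatticeType R).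
Implicit Types (x y z u v w : V) (a c : R).

Lemma vle_joinl x y : x <= vjoin x y.
Proof. by have := lexx (vjoin x y); rewrite vleUx => /andP[]. Qed.

Lemma vle_joinr x y : y <= vjoin x y.
Proof. by have := lexx (vjoin x y); rewrite vleUx => /andP[]. Qed.

Lemma vle_meetl x y : vmeet x y <= x.
Proof. by have := lexx (vmeet x y); rewrite vlexI => /andP[]. Qed.

Lemma vle_meetr x y : vmeet x y <= y.
Proof. by have := lexx (vmeet x y); rewrite vlexI => /andP[]. Qed.

Lemma vlerD x y z w : x <= y -> z <= w -> x + z <= y + w.
Proof.
move=> xy zw; apply: le_trans (vlerD2r _ _ z xy) _.
by rewrite ![y + _]addrC vlerD2r.
Qed.

Lemma vlerD2rE z x y : (x + z <= y + z) = (x <= y).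
Proof.
by apply/idP/idP => [/(vlerD2r _ _ (- z))|/vlerD2r//]; rewrite !addrK.
Qed.

Lemma vsubr_ge0 x y : (0 <= y - x) = (x <= y).
Proof. by rewrite -[LHS](vlerD2rE x) add0r subrK. Qed.

Lemma vlerBlDr x y z : (x - y <= z) = (x <= z + y).
Proof. by rewrite -[LHS](vlerD2rE y) subrK. Qed.

Lemma vlerBrDr x y z : (x <= y - z) = (x + z <= y).
Proof. by rewrite -[LHS](vlerD2rE z) subrK. Qed.

Lemma vlerN2 x y : (- x <= - y) = (y <= x).
Proof. by rewrite -[LHS]vsubr_ge0 opprK addrC vsubr_ge0. Qed.

Lemma vscaler_le a x y : 0 <= a -> x <= y -> a *: x <= a *: y.
Proof.
by move=> a0 xy; rewrite -vsubr_ge0 -scalerBr vscaler_ge0// vsubr_ge0.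
Qed.

Lemma vjoinC x y : vjoin x y = vjoin y x.
Proof. by apply/eqP; rewrite eq_le !vleUx !vle_joinl !vle_joinr. Qed.

Lemma vmeetC x y : vmeet x y = vmeet y x.
Proof. by apply/eqP; rewrite eq_le !vlexI !vle_meetl !vle_meetr. Qed.

Lemma vmeet_le x y u v : x <= u -> y <= v -> vmeet x y <= vmeet u v.
Proof.
move=> xu yv; rewrite vlexI (le_trans (vle_meetl x y) xu).
by rewrite (le_trans (vle_meetr x y) yv).
Qed.

Lemma vjoinDr x y z : vjoin (x + z) (y + z) = vjoin x y + z.
Proof.
apply/eqP; rewrite eq_le vleUx !vlerD2rE vle_joinl vle_joinr/=.
by rewrite -vlerBrDr vleUx !vlerBrDr vle_joinl vle_joinr.
Qed.

Lemma vmeetE x y : vmeet x y = x + y - vjoin x y.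
Proof.
apply/eqP; rewrite eq_le; apply/andP; split.
  rewrite -(vlerD2rE (vjoin x y)) subrK addrC -vjoinDr vleUx.
  by rewrite (addrC y) !vlerD ?vle_meetl ?vle_meetr.
rewrite vlexI !vlerBlDr; apply/andP; split.
  by rewrite vlerD ?vle_joinr.
by rewrite addrC vlerD ?vle_joinl.
Qed.

Lemma vmeetDr x y z : vmeet (x + z) (y + z) = vmeet x y + z.
Proof.
by rewrite !vmeetE vjoinDr opprD (addrACA x z y z) [LHS]addrACA addrK.
Qed.

Lemma vjoinZ a x y : 0 <= a -> vjoin (a *: x) (a *: y) = a *: vjoin x y.
Proof.
rewrite le_eqVlt => /predU1P[<-|a0].
  by rewrite !scale0r; apply/eqP; rewrite eq_le vleUx lexx vle_joinl.
apply/eqP; rewrite eq_le vleUx !vscaler_le ?vle_joinl ?vle_joinr ?(ltW a0)//=.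
rewrite -[leRHS](scalerKV (lt0r_neq0 a0)) vscaler_le ?(ltW a0)//.
rewrite vleUx -{1}[x](scalerK (lt0r_neq0 a0)) -{2}[y](scalerK (lt0r_neq0 a0)).
by rewrite !vscaler_le ?invr_ge0 ?(ltW a0) ?vle_joinl ?vle_joinr.
Qed.

Lemma vmeetZ a x y : 0 <= a -> vmeet (a *: x) (a *: y) = a *: vmeet x y.
Proof. by move=> a0; rewrite !vmeetE vjoinZ// scalerBr scalerDr. Qed.

Lemma vabsN x : vabs (- x) = vabs x.
Proof. by rewrite /vabs opprK vjoinC. Qed.

Lemma vler_abs x : x <= vabs x. Proof. exact: vle_joinl. Qed.

Lemma vabs_ge0 x : 0 <= vabs x.
Proof.
have h : 0 <= 2%:R *: vabs x.
  by rewrite scaler_nat mulr2n -(subrr x) vlerD ?vle_joinl ?vle_joinr.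
by rewrite -[vabs x](scalerK (@lt0r_neq0 _ 2%:R (ltr0n _ 2)))
  vscaler_ge0 ?invr_ge0 ?ler0n.
Qed.

Lemma vabs_le x y : (vabs x <= y) = (x <= y) && (- x <= y).
Proof. exact: vleUx. Qed.

Lemma ger0_vabs x : 0 <= x -> vabs x = x.
Proof.
move=> x0; apply/eqP; rewrite eq_le vler_abs vabs_le lexx andbT/=.
by rewrite (le_trans _ x0)// -[leRHS]oppr0 vlerN2.
Qed.

Lemma vabsD x y : vabs (x + y) <= vabs x + vabs y.
Proof. by rewrite vabs_le opprD !vlerD ?vle_joinl ?vle_joinr. Qed.

Lemma vabsZ a x : vabs (a *: x) = `|a| *: vabs x.
Proof.
wlog a0 : a x / 0 <= a => [h|].
  have [/h//|/ltW a0] := leP 0 a.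
  by rewrite -vabsN -scaleNr h ?oppr_ge0// normrN.
by rewrite /vabs -scalerN vjoinZ// ger0_norm.
Qed.

Lemma vabs_id x : vabs (vabs x) = vabs x.
Proof. by rewrite ger0_vabs ?vabs_ge0. Qed.

Lemma vabs_dist x y : vabs (vabs x - vabs y) <= vabs (x - y).
Proof.
have h u v : vabs u - vabs v <= vabs (u - v).
  by rewrite vlerBlDr; apply: le_trans (vabsD _ _); rewrite subrK.
by rewrite vabs_le h opprB -(vabsN (x - y)) opprB h.
Qed.

Lemma vjoin_abs x y : 2%:R *: vjoin x y = x + y + vabs (x - y).
Proof.
have h u v : u - v + (u + v) = 2%:R *: u.
  by rewrite addrACA addNr addr0 scaler_nat.
by rewrite /vabs opprB addrC -vjoinDr h [x + y]addrC h vjoinZ.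
Qed.

(** The meet with [z] is subadditive on the positive cone, although it is not
    additive: a lower bound of [z] and [x + y] remains a lower bound of [z]
    after a positive vector is subtracted. *)
Lemma vmeetDr_le x y z : 0 <= x -> 0 <= y -> 0 <= z ->
  vmeet z (x + y) <= vmeet z x + vmeet z y.
Proof.
move=> x0 y0 z0; set w := vmeet z (x + y).
rewrite addrC -vlerBlDr !vlexI; apply/andP; split.
  rewrite vlerBlDr (le_trans (vle_meetl _ _))// -[leLHS]addr0 vlerD// vlexI.
  by rewrite z0.
rewrite vlerBlDr addrC -vlerBlDr vlexI !vlerBlDr vle_meetr andbT.
by rewrite (le_trans (vle_meetl _ _))// -[leLHS]addr0 vlerD.
Qed.

Definition vdisjoint x y := vmeet (vabs x) (vabs y) = 0.

Lemma vmeet_ge0 x y : 0 <= x -> 0 <= y -> 0 <= vmeet x y.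
Proof. by rewrite vlexI => -> ->. Qed.

Lemma vmeet_eq0_le x y u v : 0 <= x -> 0 <= y -> x <= u -> y <= v ->
  vmeet u v = 0 -> vmeet x y = 0.
Proof.
move=> x0 y0 xu yv uv; apply/eqP.
by rewrite eq_le vmeet_ge0// andbT -uv vmeet_le.
Qed.

Lemma vdisjointD x y z : vdisjoint x z -> vdisjoint y z -> vdisjoint (x + y) z.
Proof.
rewrite /vdisjoint ![vmeet _ (vabs z)]vmeetC => xz yz.
apply: (vmeet_eq0_le (u := vabs z) (v := vabs x + vabs y)) => //;
  rewrite ?vabs_ge0 ?vabsD//.
apply/eqP; rewrite eq_le vmeet_ge0 ?andbT ?vabs_ge0//; last first.
  by rewrite -[leLHS]addr0 vlerD ?vabs_ge0.
by apply: le_trans (vmeetDr_le _ _ _) _; rewrite ?vabs_ge0// xz yz addr0.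
Qed.

(** Both multiples are dominated by multiples with the same scalar, and the meet
    is positively homogeneous. *)
Lemma vdisjointZ a c x y : vdisjoint x y -> vdisjoint (a *: x) (c *: y).
Proof.
rewrite /vdisjoint !vabsZ => xy.
have m0 : 0 <= Num.max `|a| `|c| by rewrite le_max normr_ge0.
have h d u : d <= Num.max `|a| `|c| ->
    d *: vabs u <= Num.max `|a| `|c| *: vabs u.
  move=> dm; rewrite -vsubr_ge0 -scalerBl vscaler_ge0 ?vabs_ge0//.
  by rewrite subr_ge0.
apply: (vmeet_eq0_le (u := Num.max `|a| `|c| *: vabs x)
  (v := Num.max `|a| `|c| *: vabs y)).
- by rewrite vscaler_ge0 ?vabs_ge0.
- by rewrite vscaler_ge0 ?vabs_ge0.
- by apply: h; rewrite le_max lexx.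
- by apply: h; rewrite le_max lexx orbT.
- by rewrite vmeetZ// xy scaler0.
Qed.

Lemma vdisjoint0 z : vdisjoint 0 z.
Proof.
apply/eqP; rewrite /vdisjoint eq_le vmeet_ge0 ?vabs_ge0// andbT.
by rewrite (le_trans (vle_meetl _ _))// ger0_vabs.
Qed.

(** The reverse triangle inequality gives [| |x| - |y| | <= |x - (- y)|], and
    its left-hand side is |x| + |y| minus twice the meet of |x| and |y|. *)
Lemma vabsD_disjoint x y : vdisjoint x y -> vabs (x + y) = vabs x + vabs y.
Proof.
move=> xy; apply/eqP; rewrite eq_le vabsD/=.
have := vabs_dist x (- y); rewrite opprK vabsN; apply: le_trans.
have e : vjoin (vabs x) (vabs y) = vabs x + vabs y.
  have := vmeetE (vabs x) (vabs y); rewrite xy => /esym/eqP.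
  by rewrite subr_eq0 => /eqP.
have := vjoin_abs (vabs x) (vabs y); rewrite e scaler_nat mulr2n.
by move=> /addrI <-.
Qed.

(** This is what makes a linear map commute with the absolute value when it
    sends a basis to pairwise disjoint vectors. *)
Lemma vabs_sum_disjoint (I : eqType) (s : seq I) (b : I -> R) (x : I -> V) :
  uniq s -> (forall i j, i != j -> vdisjoint (x i) (x j)) ->
  vabs (\sum_(i <- s) b i *: x i) = \sum_(i <- s) `|b i| *: vabs (x i).
Proof.
move=> + dx; elim: s => [_|i s IH]; first by rewrite !big_nil ger0_vabs.
move=> /= /andP[nis us]; rewrite !big_cons -IH// -vabsZ addrC.
rewrite vabsD_disjoint 1?addrC//.
rewrite big_seq; apply: (big_ind (fun u => vdisjoint u (b i *: x i))).
- exact: vdisjoint0.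
- by move=> u v; exact: vdisjointD.
- by move=> j js; apply/vdisjointZ/dx; apply: contraNneq nis => <-.
Qed.

Definition vpos x := vjoin x 0.

Lemma vpos_ge0 x : 0 <= vpos x. Proof. exact: vle_joinr. Qed.

Lemma vmeet_posN x : vmeet (vpos x) (vpos (- x)) = 0.
Proof.
have e : vpos x = vpos (- x) + x by rewrite -vjoinDr addNr add0r vjoinC.
have m : vmeet x 0 + vpos (- x) = 0.
  rewrite vmeetE addr0 -/(vpos x) e opprD [- _ - _]addrC addrA subrr.
  by rewrite add0r addNr.
by rewrite -[RHS]m -vmeetDr add0r [x + _]addrC -e.
Qed.

(** From [2 v - w <= - (2 u - w)]: the two vectors lie below the positive and the
    negative part of [2 u - w].  Any family that is dominated two by two by a
    common [w] is made disjoint in this way. *)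
Lemma vmeet_vpos_sub u v w : u + v <= w ->
  vmeet (vpos (2%:R *: u - w)) (vpos (2%:R *: v - w)) = 0.
Proof.
move=> uvw; apply: vmeet_eq0_le (vmeet_posN (2%:R *: u - w)) => //;
  rewrite ?vpos_ge0//.
rewrite /vpos vleUx vle_joinr andbT; apply: le_trans (vle_joinl _ _).
have := vscaler_le (ler0n R 2) uvw.
rewrite opprB vlerBlDr addrAC scalerDr [2%:R *: w]scaler_nat mulr2n.
by rewrite vlerBrDr addrC.
Qed.

End vector_lattice.

(** * Linear maps and lattice homomorphisms *)

Section linear_maps.
Variables (R : realType) (V W : lmodType R) (f : V -> W).
Hypothesis linf : linear f.

Lemma linear_fun0 : f 0 = 0.
Proof. by have := linf (-1) 0 0; rewrite scaler0 addr0 scaleN1r addNr. Qed.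

Lemma linear_funD x y : f (x + y) = f x + f y.
Proof. by have := linf 1 x y; rewrite !scale1r. Qed.

Lemma linear_funZ a x : f (a *: x) = a *: f x.
Proof. by have := linf a x 0; rewrite linear_fun0 !addr0. Qed.

Lemma linear_funN x : f (- x) = - f x.
Proof. by rewrite -scaleN1r linear_funZ scaleN1r. Qed.

Lemma linear_funB x y : f (x - y) = f x - f y.
Proof. by rewrite linear_funD linear_funN. Qed.

Lemma linear_fun_sum (I : Type) (s : seq I) (x : I -> V) :
  f (\sum_(i <- s) x i) = \sum_(i <- s) f (x i).
Proof.
elim: s => [|i s IH]; first by rewrite !big_nil linear_fun0.
by rewrite !big_cons linear_funD IH.
Qed.

End linear_maps.

Section abs_morphism.
Variables (R : realType) (V W : vectorLatticeType R) (f : V -> W).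
Hypotheses (linf : linear f) (absf : {morph f : x / vabs x}).

(** The join is half of [x + y + |x - y|], so it is enough to test a linear map
    against the absolute value. *)
Lemma abs_morph_join : {morph f : x y / vjoin x y}.
Proof.
move=> x y; apply: (scalerI (a := 2%:R)); first by rewrite pnatr_eq0.
rewrite -(linear_funZ linf) !vjoin_abs !(linear_funD linf) absf.
by rewrite (linear_funB linf).
Qed.

Lemma abs_morph_meet : {morph f : x y / vmeet x y}.
Proof.
move=> x y; rewrite !vmeetE (linear_funB linf) (linear_funD linf).
by rewrite abs_morph_join.
Qed.

End abs_morphism.

(** * Convergence in p-Banach lattices *)

(** The p-th power of the p-norm satisfies the ordinary triangle inequality, at
    the price of homogeneity; limits are computed with it. *)
Definition ppnorm (R : realType) (p : R) (X : pBanachLatticeType p)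
  (x : X) : R := pnorm x `^ p.

Definition pcvg (R : realType) (p : R) (X : pBanachLatticeType p)
    (u : nat -> X) (l : X) : Prop :=
  ppnorm (u n - l) @[n --> \oo] --> (0 : R).

Section ppnorm.
Variables (R : realType) (p : R) (hp : 0 < p <= 1) (X : pBanachLatticeType p).
Implicit Types (x y l : X) (u v : nat -> X) (a c : R).

Let p0 : 0 < p. Proof. by have /andP[] := hp. Qed.

Lemma pnorm0 : pnorm (0 : X) = 0.
Proof. by rewrite -(scale0r 0) pnormZ normr0 mul0r. Qed.

Lemma pnormN x : pnorm (- x) = pnorm x.
Proof. by rewrite -scaleN1r pnormZ normrN1 mul1r. Qed.

Lemma pnorm_vabs x : pnorm (vabs x) = pnorm x.
Proof. by apply/eqP; rewrite eq_le !le_pnorm ?vabs_id. Qed.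

Lemma ler_pnorm x y : 0 <= x -> x <= y -> pnorm x <= pnorm y.
Proof. by move=> x0 xy; rewrite le_pnorm// !ger0_vabs// (le_trans x0). Qed.

Lemma ppnorm_ge0 x : 0 <= ppnorm x. Proof. exact: powR_ge0. Qed.

Lemma ppnorm0 : ppnorm (0 : X) = 0.
Proof. by rewrite /ppnorm pnorm0 powR0// gt_eqF. Qed.

Lemma ppnorm_eq0 x : ppnorm x = 0 -> x = 0.
Proof. by move=> /powR_eq0_eq0; exact: pnorm0_eq0. Qed.

Lemma ppnormN x : ppnorm (- x) = ppnorm x.
Proof. by rewrite /ppnorm pnormN. Qed.

Lemma ppnormB x y : ppnorm (x - y) = ppnorm (y - x).
Proof. by rewrite -ppnormN opprB. Qed.

Lemma ppnormZ a x : ppnorm (a *: x) = `|a| `^ p * ppnorm x.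
Proof. by rewrite /ppnorm pnormZ powRM ?pnorm_ge0. Qed.

Lemma ler_ppnorm (Y : pBanachLatticeType p) x (y : Y) c : 0 <= c ->
  pnorm x <= c * pnorm y -> ppnorm x <= c `^ p * ppnorm y.
Proof.
move=> c0 xy; rewrite /ppnorm -powRM ?pnorm_ge0//.
by apply: ge0_ler_powR; rewrite ?nnegrE ?mulr_ge0 ?pnorm_ge0// ltW.
Qed.

Lemma ppnorm_vabs_le x y : vabs x <= vabs y -> ppnorm x <= ppnorm y.
Proof.
move=> xy; apply: ge0_ler_powR; rewrite ?nnegrE ?pnorm_ge0 ?(ltW p0)//.
exact: le_pnorm.
Qed.

Lemma ppnorm_sum (I : Type) (s : seq I) (x : I -> X) :
  ppnorm (\sum_(i <- s) x i) <= \sum_(i <- s) ppnorm (x i).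
Proof.
elim: s => [|i s IH]; first by rewrite !big_nil ppnorm0.
rewrite !big_cons; apply: le_trans (pnorm_powRD _ _) _.
by rewrite lerD2l.
Qed.

Lemma pcvg_le (Y : pBanachLatticeType p) u l (w : nat -> Y) (k : Y) c :
  (\forall n \near \oo, ppnorm (w n - k) <= c * ppnorm (u n - l)) ->
  pcvg u l -> pcvg w k.
Proof.
move=> wu ul.
apply: (@squeeze_cvgr _ _ _ _ (cst 0) (fun n => c * ppnorm (u n - l))).
- by apply: filterS wu => n ->; rewrite /ppnorm powR_ge0.
- exact: cvg_cst.
- by rewrite -[0](mulr0 c); apply: cvgMr.
Qed.

Lemma pcvg_cst l : pcvg (fun=> l) l.
Proof. by rewrite /pcvg subrr ppnorm0; exact: cvg_cst. Qed.

Lemma pcvgD u v l k : pcvg u l -> pcvg v k -> pcvg (fun n => u n + v n) (l + k).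
Proof.
move=> ul vk; rewrite /pcvg.
apply: (@squeeze_cvgr _ _ _ _ (cst 0)
  (fun n => ppnorm (u n - l) + ppnorm (v n - k))).
- near=> n; rewrite ppnorm_ge0 opprD addrACA; exact: pnorm_powRD.
- exact: cvg_cst.
- by rewrite -[X in _ --> X](addr0 0); exact: cvgD.
Unshelve. all: by end_near. Qed.

Lemma pcvgZ a u l : pcvg u l -> pcvg (fun n => a *: u n) (a *: l).
Proof.
apply: (pcvg_le (c := `|a| `^ p)); apply: nearW => n.
by rewrite -scalerBr -ppnormZ.
Qed.

Lemma pcvg_vabs u l : pcvg u l -> pcvg (fun n => vabs (u n)) (vabs l).
Proof.
apply: (pcvg_le (c := 1)); apply: nearW => n.
by rewrite mul1r; apply: ppnorm_vabs_le; exact: vabs_dist.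
Qed.

Lemma pcvg_ppnorm_le u l c :
  pcvg u l -> (\forall n \near \oo, ppnorm (u n) <= c) -> ppnorm l <= c.
Proof.
move=> ul uc; apply/ler_addgt0Pr => e e0.
have /cvgr0Pnorm_le/(_ e e0) ue := ul.
near \oo => n.
rewrite -(subrK (u n) l); apply: le_trans (pnorm_powRD _ _) _.
rewrite addrC lerD//; first by near: n.
rewrite -/(ppnorm _) ppnormB; apply: le_trans (ler_norm _) _.
by near: n.
Unshelve. all: by end_near. Qed.

Lemma pcvg_unique u l k : pcvg u l -> pcvg u k -> l = k.
Proof.
move=> ul uk; apply/subr0_eq/ppnorm_eq0/eqP; rewrite eq_le ppnorm_ge0 andbT.
rewrite addrC -scaleN1r; apply: (pcvg_ppnorm_le (pcvgD (pcvgZ (-1) uk) ul)).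
by apply: nearW => n; rewrite scaleN1r addNr ppnorm0.
Qed.

(** The sequence eventually equals its absolute value, which converges to the
    absolute value of the limit. *)
Lemma pcvg_ge0 u l : pcvg u l -> (\forall n \near \oo, 0 <= u n) -> 0 <= l.
Proof.
move=> ul u0; suff -> : l = vabs l by exact: vabs_ge0.
apply: (pcvg_unique ul); apply: (pcvg_le (c := 1)) (pcvg_vabs ul).
by apply: filterS u0 => n un; rewrite mul1r (ger0_vabs un).
Qed.

Lemma pcvg_complete u :
  (forall e : R, 0 < e -> exists N : nat, forall m n : nat,
     (N <= m)%N -> (N <= n)%N -> ppnorm (u m - u n) < e) ->
  exists l, pcvg u l.
Proof.
move=> uC; have [e e0|l ul] := pnorm_complete u.
  have [N uN] := uC _ (powR_gt0 p e0); exists N => m n Nm Nn.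
  have := uN m n Nm Nn; rewrite !ltNge; apply: contra => h.
  by apply: ge0_ler_powR; rewrite ?nnegrE ?pnorm_ge0// ltW.
exists l; apply/cvgr0Pnorm_lt => e e0.
have /cvgr0Pnorm_lt/(_ (e `^ p^-1)) := ul.
rewrite powR_gt0// => /(_ isT); apply: filterS => n.
rewrite [ltLHS]ger0_norm ?pnorm_ge0// ger0_norm ?powR_ge0// => h.
have -> : e = (e `^ p^-1) `^ p.
  by rewrite -powRrM mulVf ?gt_eqF// powRr1// ltW.
by apply: gt0_ltr_powR; rewrite ?nnegrE ?powR_ge0 ?pnorm_ge0.
Qed.

End ppnorm.

Section homomorphisms.
Variables (R : realType) (p : R) (hp : 0 < p <= 1).
Implicit Types X Z : pBanachLatticeType p.

Section bounded_maps.
Variables (X Z : pBanachLatticeType p) (f : X -> Z).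
Hypothesis linf : linear f.

Lemma bounded_continuous M : (forall x, pnorm (f x) <= M * pnorm x) ->
  pnorm_continuous f.
Proof.
move=> fM x e e0; have M0 : 0 < `|M| + 1 by rewrite ltr_wpDl.
exists (e / (`|M| + 1)); first by rewrite divr_gt0.
move=> y; rewrite -(linear_funB linf) ltr_pdivlMr// => h.
apply: le_lt_trans h; apply: le_trans (fM _) _.
rewrite mulrC ler_wpM2l ?pnorm_ge0//.
by rewrite (le_trans (ler_norm _))// lerDl.
Qed.

Lemma continuous_bounded : pnorm_continuous f ->
  forall x, pnorm (f x) <= opnorm f * pnorm x.
Proof.
move=> /(_ 0 1 ltr01)[d d0 fd].
have ub : has_ubound [set pnorm (f x) | x in [set x : X | pnorm x <= 1]].
  exists (2 / d) => _ [x /= x1 <-].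
  have := fd ((d / 2) *: x).
  rewrite subr0 (linear_fun0 linf) subr0 (linear_funZ linf).
  rewrite !pnormZ.
  rewrite ger0_norm ?divr_ge0 ?(ltW d0)// => h.
  have d20 : 0 < d / 2 by rewrite divr_gt0.
  rewrite -invf_div -[leRHS]mul1r ler_pdivlMr// mulrC ltW// h//.
  apply: le_lt_trans (_ : d / 2 < d); last first.
    by rewrite ltr_pdivrMr// ltr_pMr// ltr1n.
  by rewrite ler_piMr// ltW.
move=> x; have [x0|x0] := eqVneq (pnorm x) 0.
  by rewrite (pnorm0_eq0 _ x0) (linear_fun0 linf) !pnorm0 mulr0.
have xp : 0 < pnorm x by rewrite lt_neqAle eq_sym x0 pnorm_ge0.
rewrite -ler_pdivrMr//; apply: ub_le_sup => //.
exists ((pnorm x)^-1 *: x).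
  by rewrite /= pnormZ gtr0_norm ?invr_gt0// mulVf.
by rewrite (linear_funZ linf) pnormZ gtr0_norm ?invr_gt0// mulrC.
Qed.


Lemma opnorm_le M : 0 <= M -> (forall x, pnorm (f x) <= M * pnorm x) ->
  opnorm f <= M.
Proof.
move=> M0 fM; apply: ge_sup.
  by exists (pnorm (f 0)), 0; rewrite /= ?pnorm0.
move=> _ [x /= x1 <-]; apply: le_trans (fM x) _.
by rewrite ler_piMr.
Qed.

Lemma opnorm_ge0 : 0 <= opnorm f.
Proof.
rewrite /opnorm; set A := [set _ | _ in _].
have [hA|/sup_out->//] := pselect (has_sup A).
have [[c Ac] _] := hA; apply: le_trans (sup_upper_bound hA Ac).
by case: Ac => x _ <-; exact: pnorm_ge0.
Qed.

Lemma pcvg_bounded M u l : 0 <= M -> (forall x, pnorm (f x) <= M * pnorm x) ->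
  pcvg u l -> pcvg (fun n => f (u n)) (f l).
Proof.
move=> M0 fM; apply: (pcvg_le (c := M `^ p)); apply: nearW => n.
by rewrite -(linear_funB linf); exact: ler_ppnorm.
Qed.

End bounded_maps.

Lemma lattice_hom_vabs X Z (f : X -> Z) :
  lattice_hom f -> {morph f : x / vabs x}.
Proof.
by move=> [linf _ _ fj] x; rewrite /vabs fj (linear_funN linf).
Qed.

(** Any constant greater than 1 would do instead of 2.  Positivity is free:
    replace a lift by its absolute value. *)
Lemma lattice_quotient_lift X Z (f : X -> Z) : lattice_quotient f ->
  forall z : Z, 0 <= z ->
  exists x, [/\ 0 <= x, f x = z & pnorm x <= 2 * pnorm z].
Proof.
move=> [fh fs fq] z z0; have [fl _ _ _] := fh.
have [zn0|zn0] := eqVneq (pnorm z) 0.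
  exists 0; rewrite (linear_fun0 fl) pnorm0 (pnorm0_eq0 _ zn0) pnorm0 mulr0.
  by split.
have zp : 0 < pnorm z by rewrite lt_neqAle eq_sym zn0 pnorm_ge0.
have [|_ [x /= xz <-] xlt] :=
  inf_adherent (E := [set pnorm x | x in f @^-1` [set z]]) zp.
  split; last by exists 0 => _ [x _ <-]; exact: pnorm_ge0.
  by have [x _ xz] := fs z I; exists (pnorm x), x.
exists (vabs x); split; first exact: vabs_ge0.
  by rewrite (lattice_hom_vabs fh) xz ger0_vabs.
by rewrite pnorm_vabs mulr_natl mulr2n {1}fq ltW.
Qed.

End homomorphisms.

(** * Unit vectors of l_p *)

Section ellp_basis.
Variables (R : realType) (p : R) (hp : 0 < p <= 1) (Gamma : choiceType).
Local Notation L := (ellp hp Gamma).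
Implicit Types (b c : L) (g : Gamma) (s : seq Gamma).

Let p0 : 0 < p. Proof. by have /andP[] := hp. Qed.

Lemma ellp_ppnormE b : ppnorm b = fine (psum p b).
Proof. exact: ellp_norm_powR. Qed.

Lemma ellp_sum_le_ppnorm s b : uniq s ->
  \sum_(g <- s) `|b g| `^ p <= ppnorm b.
Proof.
move=> us; rewrite ellp_ppnormE -lee_fin fineK ?psum_fin// -sumEFin.
apply: esum_ge; exists [set` s]; first by split => //; exact: finite_seq.
by rewrite -fsbig_seq.
Qed.

Lemma ellp_coord_le b g : `|b g| <= pnorm b.
Proof.
have := @ellp_sum_le_ppnorm [:: g] b isT; rewrite big_seq1 => h.
rewrite leNgt; apply/negP => /(gt0_ltr_powR p0).
rewrite !nnegrE pnorm_ge0 normr_ge0 => /(_ isT isT).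
by rewrite ltNge h.
Qed.

Lemma ellp_sumE (I : Type) (t : seq I) (F : I -> L) g :
  (\sum_(i <- t) F i) g = \sum_(i <- t) F i g.
Proof. by elim: t => [|i t IH]; rewrite ?big_nil// !big_cons -IH. Qed.

Lemma psum_delta g : psum p (fun i => (i == g)%:R) = 1%E.
Proof.
rewrite /psum (_ : (fun i => _) = fun i => if i \in [set g] then 1%E else 0%E).
  by rewrite -esum_mkcond esum_set1.
apply/funext => i; have [->|/eqP ig] := eqVneq i g.
  by rewrite mem_set// normr1 powR1.
by rewrite memNset// normr0 powR0// gt_eqF.
Qed.

Fact ellp_delta_subproof g : ellp_pred hp (fun i : Gamma => (i == g)%:R : R).
Proof. by rewrite /ellp_pred psum_delta ltry. Qed.

Definition ellp_delta g : L := Ellp (ellp_delta_subproof g).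

Lemma pnorm_ellp_delta g : pnorm (ellp_delta g) = 1.
Proof. by rewrite /pnorm/= /ellp_norm psum_delta/= powR1. Qed.

Lemma ellp_delta_ge0 g : 0 <= ellp_delta g.
Proof. by apply/ellp_leP => i /=; rewrite ler0n. Qed.

Lemma ellp_meet_delta g h : g != h -> vmeet (ellp_delta g) (ellp_delta h) = 0.
Proof.
move=> gh; apply/val_inj/funext => i /=.
rewrite [LHS]meetfE meetEtotal /=.
have [->|] := eqVneq i g; first by rewrite (negbTE gh) min_r.
by move=> _; rewrite min_l.
Qed.

End ellp_basis.

(** * Linear maps on l_p over a countable set *)

Section basis_sum.
Variables (R : realType) (p : R) (hp : 0 < p <= 1) (Gamma : choiceType).
Variables (code : Gamma -> nat) (decode : nat -> option Gamma).
Hypotheses (decodeK : ocancel decode code) (codeK : pcancel code decode).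
Local Notation L := (ellp hp Gamma).
Implicit Types (b c : L) (g : Gamma).

Let p0 : 0 < p. Proof. by have /andP[] := hp. Qed.

(** Increasing finite lists with union Gamma, along which infinite sums over
    Gamma are taken. *)
Definition exhaustion N : seq Gamma := pmap decode (iota 0 N).

Lemma exhaustion_uniq N : uniq (exhaustion N).
Proof. by apply: (pmap_uniq decodeK); exact: iota_uniq. Qed.

Lemma mem_exhaustion g N : (g \in exhaustion N) = (code g < N)%N.
Proof.
rewrite mem_pmap; apply/mapP/idP => [[n]|gN].
  rewrite mem_iota/= add0n => nN e.
  by have := decodeK n; rewrite -e /= => ->.
by exists (code g); rewrite ?mem_iota// codeK.
Qed.

Lemma exhaustion_cat m n : (m <= n)%N ->
  exists2 s, uniq s & exhaustion n = exhaustion m ++ s.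
Proof.
move=> mn; exists (pmap decode (iota m (n - m))).
  by apply: (pmap_uniq decodeK); exact: iota_uniq.
by rewrite -pmap_cat -[X in iota X _]add0n -iotaD subnKC.
Qed.

(** For a bounded family [y], [S] is the continuous linear map with value [y g]
    at each unit vector.  The
    relation determines [S], is stable under composition, and holds for every
    bounded linear map and its values at the unit vectors: equalities between
    bounded linear maps are checked on the unit vectors in this way. *)
Definition basis_sum (X : pBanachLatticeType p) (y : Gamma -> X) (S : L -> X) :=
  forall b, pcvg (fun N => \sum_(g <- exhaustion N) b g *: y g) (S b).

Section fixed_family.
Variables (X : pBanachLatticeType p) (y : Gamma -> X).

Lemma basis_sum_unique S S' : basis_sum y S -> basis_sum y S' -> S = S'.
Proof.
by move=> yS yS'; apply/funext => b; exact: (pcvg_unique hp (yS b) (yS' b)).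
Qed.

Lemma basis_sum_linear S : basis_sum y S -> linear S.
Proof.
move=> yS a b c; apply: (pcvg_unique hp (yS _)).
have := pcvgD (pcvgZ a (yS b)) (yS c); rewrite /pcvg.
set u := (fun n => _); set v := (fun n => _); suff -> : u = v by [].
apply/funext => n; rewrite {}/u {}/v scaler_sumr -big_split/=.
congr (ppnorm (_ - _)); apply: eq_bigr => g _.
by rewrite scalerA -scalerDl.
Qed.

Lemma basis_sum_comp (Z : pBanachLatticeType p) (f : X -> Z) S :
  linear f -> pnorm_continuous f ->
  basis_sum y S -> basis_sum (f \o y) (f \o S).
Proof.
move=> lf cf yS b.
have := pcvg_bounded hp lf (opnorm_ge0 f) (continuous_bounded lf cf) (yS b).
rewrite /pcvg; under [X in X @ _ --> _ -> _]eq_fun => n.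
  rewrite (linear_fun_sum lf); under eq_bigr do rewrite (linear_funZ lf). over.
by [].
Qed.

Variable K : R.
Hypothesis yK : forall g, pnorm (y g) <= K.

Let ppnorm_seq s b :
  ppnorm (\sum_(g <- s) b g *: y g) <= K `^ p * \sum_(g <- s) `|b g| `^ p.
Proof.
apply: le_trans (ppnorm_sum hp _ _) _; rewrite mulr_sumr; apply: ler_sum => g _.
rewrite ppnormZ mulrC ler_wpM2r ?powR_ge0//.
have K0 : 0 <= K := le_trans (pnorm_ge0 _) (yK g).
by apply: ge0_ler_powR; rewrite ?nnegrE ?pnorm_ge0// ltW.
Qed.

(** The series is absolutely convergent: its Cauchy differences are bounded by
    those of the partial sums of [|b g| ^ p], which increase and stay below
    [ppnorm b]. *)
Lemma basis_sum_exists : exists S, basis_sum y S.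
Proof.
suff /choice[S yS] : forall b, exists l,
    pcvg (fun N => \sum_(g <- exhaustion N) b g *: y g) l by exists S.
move=> b; apply: (pcvg_complete hp) => e e0.
(* The scalar partial sums that dominate the vector ones. *)
pose t N : R := \sum_(g <- exhaustion N) `|b g| `^ p.
have tB m n : (m <= n)%N -> 0 <= t n - t m /\
    ppnorm (\sum_(g <- exhaustion n) b g *: y g -
            \sum_(g <- exhaustion m) b g *: y g) <= K `^ p * (t n - t m).
  move=> /exhaustion_cat[s us E]; rewrite /t E !big_cat/=.
  rewrite ![_ + _ - _]addrAC !subrr !add0r.
  by split; [apply: sumr_ge0 => g _; exact: powR_ge0|exact: ppnorm_seq].
have tnd : nondecreasing_seq t.
  by move=> m n /tB[]; rewrite subr_ge0.
have tc : cvgn t.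
  apply: nondecreasing_is_cvgn => //; exists (ppnorm b) => _ [n _ <-].
  by apply: ellp_sum_le_ppnorm; exact: exhaustion_uniq.
have K1 : 0 < K `^ p + 1 by rewrite ltr_wpDl ?powR_ge0.
have /cvgrPdist_lt/(_ (e / (K `^ p + 1))) := tc.
rewrite divr_gt0// => /(_ isT)[N _ hN]; exists N.
have h m n : (N <= m)%N -> (m <= n)%N -> K `^ p * (t n - t m) < e.
  move=> Nm mn; apply: (@le_lt_trans _ _ ((K `^ p + 1) * (limn t - t m))).
    have [tmn _] := tB m n mn.
    apply: ler_pM; rewrite ?powR_ge0 ?lerDl// lerB//.
    exact: nondecreasing_cvgn_le.
  rewrite mulrC -ltr_pdivlMr//; apply: le_lt_trans (hN m Nm).
  exact: ler_norm.
move=> m n Nm Nn; have [mn|/ltnW nm] := leqP m n.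
  by rewrite ppnormB; apply: le_lt_trans (h m n Nm mn); have [] := tB m n mn.
by apply: le_lt_trans (h n m Nn nm); have [] := tB n m nm.
Qed.

Lemma basis_sum_bounded S : 0 <= K -> basis_sum y S ->
  forall b, pnorm (S b) <= K * pnorm b.
Proof.
move=> K0 yS b; rewrite leNgt; apply/negP => /(gt0_ltr_powR p0).
rewrite !nnegrE mulr_ge0 ?pnorm_ge0// => /(_ isT isT); apply/negP.
rewrite -leNgt powRM ?pnorm_ge0//; apply: (pcvg_ppnorm_le (yS b)).
apply: nearW => n; apply: le_trans (ppnorm_seq _ _) _.
rewrite ler_wpM2l ?powR_ge0//; apply: ellp_sum_le_ppnorm.
exact: exhaustion_uniq.
Qed.

Lemma basis_sum_ge0 S : basis_sum y S -> (forall g, 0 <= y g) ->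
  forall b, 0 <= b -> 0 <= S b.
Proof.
move=> yS y0 b /ellp_leP b0; apply: (pcvg_ge0 hp (yS b)); apply: nearW => n.
elim/big_ind: _ => [|u v u0 v0|g _]; [exact: lexx| |].
  by rewrite -(addr0 0) vlerD.
by apply: vscaler_ge0 => //; exact: b0.
Qed.

(** Each partial sum commutes with the absolute value by disjointness, hence so
    does the limit. *)
Lemma basis_sum_lattice_hom S :
  0 <= K -> basis_sum y S -> (forall g, 0 <= y g) ->
  (forall g h, g != h -> vmeet (y g) (y h) = 0) -> lattice_hom S.
Proof.
move=> K0 yS y0 dy; have lS := basis_sum_linear yS.
suff absS : {morph S : b / vabs b}.
  split=> //; first exact: (bounded_continuous lS (basis_sum_bounded K0 yS)).
    exact: abs_morph_meet.
  exact: abs_morph_join.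
move=> b; apply: (pcvg_unique hp (yS _)).
have := pcvg_vabs hp (yS b); rewrite /pcvg.
set u := (fun n => _); set v := (fun n => _); suff -> : u = v by [].
apply/funext => n; rewrite {}/u {}/v vabs_sum_disjoint ?exhaustion_uniq//.
  congr (ppnorm (_ - _)); apply: eq_bigr => g _.
  by rewrite ellp_vabsE ger0_vabs.
by move=> g h gh; rewrite /vdisjoint !ger0_vabs// dy.
Qed.

End fixed_family.

(** The unit vectors are a basis of l_p(Gamma).  Their partial sums converge by
    completeness, and the limit is identified coordinatewise, since coordinates
    are continuous and each one is eventually constant along the sums. *)
Lemma basis_sum_delta : basis_sum (@ellp_delta R p hp Gamma) id.
Proof.
have d1 g : pnorm (ellp_delta hp g) <= 1 by rewrite pnorm_ellp_delta.
have [S dS] := basis_sum_exists d1.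
suff <- : S = id by [].
apply/funext => b; apply/val_inj/funext => g /=.
set u := (fun N => \sum_(h <- exhaustion N) b h *: ellp_delta hp h) in dS *.
apply/subr0_eq/normr0_eq0/powR_eq0_eq0/eqP; rewrite eq_le powR_ge0 andbT.
apply/ler_addgt0Pr => e e0; rewrite add0r.
have /cvgr0Pnorm_le/(_ e e0) ue := dS b.
near \oo => N.
have ubg : u N g = b g.
  have gN : (code g < N)%N by near: N; exact: nbhs_infty_gt.
  rewrite /u ellp_sumE (bigD1_seq g) ?mem_exhaustion ?exhaustion_uniq//.
  rewrite big1 ?Monoid.mulm1.
    by rewrite [LHS]/(b g * (g == g)%:R) eqxx; exact: mulr1.
  move=> h hg; rewrite [LHS]/(b h * (g == h)%:R) eq_sym (negbTE hg).
  exact: mulr0.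
have -> : S b g - b g = (S b - u N) g by rewrite -ubg.
have := @ellp_sum_le_ppnorm R p hp Gamma [:: g] (S b - u N) isT.
rewrite big_seq1 => /le_trans; apply; rewrite ppnormB.
by apply: le_trans (ler_norm _) _; near: N.
Unshelve. all: by end_near. Qed.

Lemma basis_sum_eval (X : pBanachLatticeType p) (y : Gamma -> X) S g :
  basis_sum y S -> S (ellp_delta hp g) = y g.
Proof.
move=> yS; apply: (pcvg_unique hp (yS _)).
have := pcvg_cst hp (y g); apply: (pcvg_le (c := 1)).
near=> N; rewrite mul1r.
have gN : (code g < N)%N by near: N; exact: nbhs_infty_gt.
rewrite (bigD1_seq g) ?mem_exhaustion ?exhaustion_uniq//= eqxx scale1r.
rewrite big1 ?addr0//.
by move=> h hg; rewrite (negbTE hg) scale0r.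
Unshelve. all: by end_near. Qed.

Lemma basis_sum_hom (X : pBanachLatticeType p) (T : L -> X) :
  linear T -> pnorm_continuous T -> basis_sum (T \o @ellp_delta R p hp Gamma) T.
Proof. by move=> lT cT; exact: basis_sum_comp lT cT basis_sum_delta. Qed.

End basis_sum.

(** * Projectivity in the countable case *)

Lemma countable_enumeration (T : Type) : countable [set: T] ->
  exists (e : T -> nat) (f : nat -> option T), ocancel f e /\ pcancel e f.
Proof.
move=> /countable_injP[e /in2TT e_inj].
pose f n :=
  if pselect (exists x, e x = n) is left h then Some (projT1 (cid h)) else None.
exists e, f; split=> [n|x]; rewrite /f; case: pselect => //=.
  by move=> h; exact: projT2 (cid h).
- move=> h; congr Some; apply: e_inj; exact: projT2 (cid h).
- by case; exists x.
Qed.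

Section countable_projective.
Variables (R : realType) (p : R) (hp : 0 < p <= 1) (Gamma : choiceType).
Variables (code : Gamma -> nat) (decode : nat -> option Gamma).
Hypotheses (decodeK : ocancel decode code) (codeK : pcancel code decode).
Local Notation L := (ellp hp Gamma).
Local Notation delta := (@ellp_delta R p hp Gamma).

Let p0 : 0 < p. Proof. by have /andP[] := hp. Qed.

(** The exponent [p^-1] makes the p-th powers [2^-n], whose sum is finite. *)
Let eps (g : Gamma) : R := (2^-1 ^+ code g) `^ p^-1.

Let eps_gt0 g : 0 < eps g.
Proof. by rewrite powR_gt0// exprn_gt0// invr_gt0. Qed.

Fact weak_unit_subproof : ellp_pred hp eps.
Proof.
rewrite /ellp_pred /psum.
rewrite (eq_esum (b := fun g => (2^-1 ^+ code g)%:E)); last first.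
  by move=> g _; rewrite gtr0_norm ?eps_gt0// -powRrM mulVf ?gt_eqF// powRr1.
have code_inj : set_inj [set: Gamma] code.
  by move=> g h _ _; exact: (pcan_inj codeK).
rewrite -(@esum_image _ _ _ _ _ (fun n => (2^-1 ^+ n : R)%:E) code_inj).
have half_ge0 n : (0 <= (2^-1 ^+ n : R)%:E)%E.
  by rewrite lee_fin exprn_ge0// invr_ge0.
apply: (@le_lt_trans _ _ (\esum_(n in [set: nat]) (2^-1 ^+ n : R)%:E)).
  by rewrite esum_mkcond; apply: le_esum => n _; case: ifP.
rewrite -nneseries_esumT//.
have half1 : `|2^-1 : R| < 1 by rewrite gtr0_norm ?invr_gt0// invf_lt1// ltr1n.
have hs := @cvg_geometric_series R 1 _ half1.
rewrite (_ : (fun n => _) = EFin \o series (geometric 1 2^-1)); last first.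
  apply/funext => n /=; rewrite sumEFin; congr _%:E.
  by apply: eq_bigr => k _; rewrite /= mul1r.
by rewrite EFin_lim ?ltry//; exact: cvgP hs.
Qed.

Let w : L := Ellp weak_unit_subproof.

Lemma weak_unit_ge (g h : Gamma) : g != h ->
  eps g *: delta g + eps h *: delta h <= w.
Proof.
move=> gh; apply/ellp_leP => i.
suff : eps g * (i == g)%:R + eps h * (i == h)%:R <= eps i by [].
have [->|] := eqVneq i g; first by rewrite (negbTE gh) mulr1 mulr0 addr0.
move=> _; rewrite mulr0 add0r.
by have [->|_] := eqVneq i h; rewrite ?mulr1// mulr0 ltW.
Qed.

Lemma weak_unit_ge1 (g : Gamma) : eps g *: delta g <= w.
Proof.
apply/ellp_leP => i; suff : eps g * (i == g)%:R <= eps i by [].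
by have [->|_] := eqVneq i g; rewrite ?mulr1// mulr0 ltW.
Qed.

(** At the coordinate [g] both sides are [eps g]; at any other coordinate the
    positive part removes [- eps i].  The identity uses only lattice operations
    and [w], so it survives under lattice homomorphisms. *)
Lemma weak_unit_vpos g :
  vpos (2%:R *: (eps g *: delta g) - w) = eps g *: delta g.
Proof.
apply/val_inj/funext => i; rewrite [LHS]joinfE joinEtotal.
suff : Num.max (2%:R * (eps g * (i == g)%:R) - eps i) 0 =
  eps g * (i == g)%:R by [].
have [->|_] := eqVneq i g.
  by rewrite mulr1 mulr_natl mulr2n addrK max_l// ltW.
by rewrite !mulr0 add0r max_r// oppr_le0 ltW.
Qed.

(** Disjointness of the images of the unit vectors is transported to X by the
    formula of [weak_unit_vpos], in which [w] is replaced by the image of [w]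
    under a lift [S0] of [T] that is only linear and positive. *)
Lemma ellp_lambda_projective : lambda_projective 2 (L : pBanachLatticeType p).
Proof.
move=> X Z pi T qpi hT.
have [hpi _ _] := qpi; have [lpi cpi _ jpi] := hpi; have [lT cT _ jT] := hT.
have delta_le g : pnorm (T (delta g)) <= opnorm T.
  by have := continuous_bounded lT cT (delta g); rewrite pnorm_ellp_delta mulr1.
have Tdelta_ge0 g : 0 <= T (delta g).
  rewrite -[delta g]ger0_vabs ?ellp_delta_ge0// (lattice_hom_vabs hT).
  exact: vabs_ge0.
have /choice[y yP] : forall g, exists x,
    [/\ 0 <= x, pi x = T (delta g) & pnorm x <= 2 * pnorm (T (delta g))].
  by move=> g; exact: lattice_quotient_lift.
have y0 g : 0 <= y g by have [] := yP g.
have piy g : pi (y g) = T (delta g) by have [] := yP g.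
pose K := 2 * opnorm T.
have K0 : 0 <= K by rewrite mulr_ge0// opnorm_ge0.
have yK g : pnorm (y g) <= K.
  by have [_ _ /le_trans] := yP g; apply; rewrite ler_wpM2l// delta_le.
have [S0 S0y] := basis_sum_exists hp decodeK yK.
have lS0 := basis_sum_linear S0y.
have S0d g : S0 (delta g) = y g by exact: (basis_sum_eval decodeK codeK g S0y).
have piS0 : pi \o S0 = T.
  apply: (@basis_sum_unique _ _ _ _ _ _ (T \o delta)).
    have -> : T \o delta = pi \o y by apply/funext => g /=; rewrite piy.
    exact: basis_sum_comp.
  exact: basis_sum_hom.
have S0_le b c : b <= c -> S0 b <= S0 c.
  move=> bc; rewrite -vsubr_ge0 -(linear_funB lS0).
  by apply: (basis_sum_ge0 S0y y0); rewrite vsubr_ge0.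
(* The copy in X of the formula that isolates a unit vector from [w]. *)
pose u g := vpos (2%:R *: (eps g *: y g) - S0 w).
pose x g := (eps g)^-1 *: u g.
have x0 g : 0 <= x g by rewrite vscaler_ge0 ?vpos_ge0// invr_ge0 ltW.
have xy g : x g <= y g.
  have eg0 := ltW (eps_gt0 g).
  rewrite -[leRHS](scalerK (lt0r_neq0 (eps_gt0 g))) vscaler_le ?invr_ge0//.
  rewrite /u /vpos vleUx vscaler_ge0// andbT.
  rewrite scaler_nat mulr2n vlerBlDr vlerD// -S0d -(linear_funZ lS0).
  exact/S0_le/weak_unit_ge1.
have pix g : pi (x g) = T (delta g).
  rewrite /x /u /vpos (linear_funZ lpi) jpi (linear_fun0 lpi) (linear_funB lpi).
  rewrite !(linear_funZ lpi) piy -[pi (S0 w)]/((pi \o S0) w) piS0.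
  (* Everything is now the image under T of the identity in l_p. *)
  rewrite -!(linear_funZ lT) -(linear_funB lT) -(linear_fun0 lT) -jT.
  by rewrite -/(vpos _) weak_unit_vpos (linear_funZ lT) scalerK ?gt_eqF.
have dx g h : g != h -> vmeet (x g) (x h) = 0.
  move=> gh; suff : vdisjoint (u g) (u h).
    move=> /(vdisjointZ (eps g)^-1 (eps h)^-1).
    by rewrite /vdisjoint !ger0_vabs ?x0.
  rewrite /vdisjoint !ger0_vabs ?vpos_ge0//; apply: vmeet_vpos_sub.
  rewrite -!S0d -!(linear_funZ lS0) -(linear_funD lS0).
  exact/S0_le/weak_unit_ge.
have xK g : pnorm (x g) <= K.
  exact: le_trans (ler_pnorm (x0 g) (xy g)) (yK g).
have [S Sx] := basis_sum_exists hp decodeK xK.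
have lS := basis_sum_linear Sx.
exists S; split.
- exact: (basis_sum_lattice_hom decodeK xK K0 Sx x0 dx).
- apply: (@basis_sum_unique _ _ _ _ _ _ (T \o delta)).
    have -> : T \o delta = pi \o x by apply/funext => g /=; rewrite pix.
    exact: basis_sum_comp.
  exact: basis_sum_hom.
- by apply: opnorm_le => //; exact: (basis_sum_bounded decodeK xK K0 Sx).
Qed.

End countable_projective.

(** * Spaces of bounded functions with prescribed limits *)

Section cfun_pred.
Variables (R : realType) (p : R) (Gamma I : Type) (C : set (I * (Gamma -> I))).
Implicit Types f g h : I -> R.

(** A pair (i, k) of [C] says that the points [k d] of [I] converge to [i] as [d]
    leaves every finite subset of Gamma.  Only these convergences matter below,
    and listing them avoids a topology on [I]. *)
Definition cfun_prop f : Prop :=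
  (exists M, forall i, `|f i| <= M) /\
  forall i k, C (i, k) -> forall e, 0 < e ->
    finite_set [set d | e < `|f (k d) - f i|].

Definition cfun_pred of 0 < p <= 1 : pred (I -> R) :=
  fun f => `[< cfun_prop f >].

(** All the lattice operations are Lipschitz, and this is enough for them to
    preserve the prescribed limits. *)
Lemma cfun_prop_lip A f g h : 0 <= A ->
  (forall i, `|h i| <= A * (`|f i| + `|g i|)) ->
  (forall i j, `|h i - h j| <= A * (`|f i - f j| + `|g i - g j|)) ->
  cfun_prop f -> cfun_prop g -> cfun_prop h.
Proof.
move=> A0 hb hl [[M fM] fC] [[N gN] gC]; split.
  exists (A * (M + N)) => i; apply: le_trans (hb i) _.
  by rewrite ler_wpM2l// lerD.
move=> i k ik e e0; have A1 : 0 < A + 1 by rewrite ltr_wpDl.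
have e1 : 0 < e / (A + 1) / 2 by rewrite !divr_gt0.
have := conj (fC i k ik _ e1) (gC i k ik _ e1); rewrite -finite_setU.
apply: sub_finite_set => d /= ed; apply: contrapT => /not_orP[/negP + /negP].
rewrite -!leNgt => fd gd.
have := lt_le_trans ed (hl (k d) i); apply/negP; rewrite -leNgt.
apply: (@le_trans _ _ ((A + 1) * (e / (A + 1)))).
  rewrite ler_pM ?addr_ge0 ?lerDl// [leRHS]splitr; exact: lerD.
by rewrite mulrC divfK ?gt_eqF.
Qed.

Lemma cfun_prop0 : cfun_prop 0.
Proof.
split; first by exists 0 => i; rewrite normr0.
move=> i k _ e e0; rewrite (_ : [set _ | _] = set0)//.
by apply/seteqP; split=> d //=; rewrite subrr normr0 ltNge ltW.
Qed.

Lemma cfun_propD a f g : cfun_prop f -> cfun_prop g -> cfun_prop (a *: f + g).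
Proof.
have h s t : `|a * s + t| <= (`|a| + 1) * (`|s| + `|t|).
  apply: le_trans (ler_normD _ _) _; rewrite normrM mulrDr lerD//.
    by rewrite ler_wpM2r// lerDl.
  by rewrite ler_peMl// lerDr.
apply: (cfun_prop_lip (A := `|a| + 1)); first by rewrite addr_ge0.
  by move=> i; exact: h.
move=> i j; apply: le_trans (h _ _).
by rewrite opprD addrACA -mulrBr.
Qed.

Lemma cfun_prop_meet f g : cfun_prop f -> cfun_prop g ->
  cfun_prop (Order.meet f g).
Proof.
apply: (cfun_prop_lip ler01) => [i|i j]; rewrite mul1r !meetfE !meetEtotal.
  by rewrite /Order.min; case: ifP => _; rewrite ?lerDl ?lerDr.
have := normr_ge0 (f i - f j); have := normr_ge0 (g i - g j).
have := lexx `|f i - f j|; have := lexx `|g i - g j|; rewrite 2!{1}ler_norml.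
move=> /andP[? ?] /andP[? ?] ? ?; rewrite ler_norml /Order.min.
by apply/andP; split; case: ltP => ?; case: ltP => ?; lra.
Qed.

Lemma cfun_prop_lim (u : nat -> I -> R) l : (forall n, cfun_prop (u n)) ->
  (forall e, 0 < e -> exists n, forall i, `|u n i - l i| <= e) -> cfun_prop l.
Proof.
move=> uP ul; split.
  have [n un] := ul 1 ltr01; have [[M uM] _] := uP n.
  exists (1 + M) => i; rewrite -(subrK (u n i) (l i)).
  by apply: le_trans (ler_normD _ _) _; rewrite lerD// distrC.
move=> i k ik e e0; have e3 : 0 < e / 3 by rewrite divr_gt0.
have [n un] := ul _ e3; have [_ /(_ i k ik _ e3)] := uP n.
apply: sub_finite_set => d /= ed; rewrite ltNge; apply/negP => h.
have := un (k d); have := un i; move: h ed; rewrite !ler_norml ltr_normr.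
move=> /andP[? ?] /orP[] ? /andP[? ?] /andP[? ?]; lra.
Qed.

End cfun_pred.

(** The proof [hp] is an argument of the type because the sup norm is a p-norm
    only for p in (0, 1]. *)
Record cfun (R : realType) (p : R) (hp : 0 < p <= 1) (Gamma I : Type)
    (C : set (I * (Gamma -> I))) :=
  Cfun { cfun_fun :> I -> R; _ : cfun_pred C hp cfun_fun }.

Section cfun_instances.
Variables (R : realType) (p : R) (hp : 0 < p <= 1) (Gamma I : Type).
Variable C : set (I * (Gamma -> I)).
Local Notation S := (@cfun_pred R p Gamma I C hp).
Local Notation L := (cfun hp C).
Implicit Types f g : L.

Let p0 : 0 < p. Proof. by have /andP[] := hp. Qed.

HB.instance Definition _ := [isSub for @cfun_fun R p hp Gamma I C].
HB.instance Definition _ := [Choice of L by <:].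

Lemma cfun_submod : submod_closed S.
Proof.
split; first by apply/asboolP; exact: cfun_prop0.
by move=> a f g /asboolP fP /asboolP gP; apply/asboolP; exact: cfun_propD.
Qed.

HB.instance Definition _ := GRing.isSubmodClosed.Build R (I -> R) S cfun_submod.
HB.instance Definition _ := [SubChoice_isSubLmodule of L by <:].

HB.instance Definition _ := Order.SubChoice_isSubPOrder.Build _ (I -> R) S
  ring_display L.

Lemma cfunP f : cfun_prop C f. Proof. by have /asboolP := valP f. Qed.

Definition cfun_meet f g : L :=
  Cfun (asboolT (cfun_prop_meet (cfunP f) (cfunP g)) : S _).
Definition cfun_join f g : L := - cfun_meet (- f) (- g).

Lemma cfun_leP f g : reflect (forall i, f i <= g i) (f <= g).
Proof. by rewrite -Order.le_val; apply: (iffP (lefP _ _)). Qed.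

Fact cfun_lexI f g h : (f <= cfun_meet g h) = (f <= g) && (f <= h).
Proof. by rewrite -!Order.le_val lexI. Qed.

Fact cfun_leUx f g h : (cfun_join f g <= h) = (f <= h) && (g <= h).
Proof.
have leN (a b : L) : (- a <= b) = (- b <= a).
  by apply/cfun_leP/cfun_leP => ab i; rewrite lerNl; exact: ab.
by rewrite leN cfun_lexI leN [- h <= - g]leN !opprK.
Qed.

Fact cfun_lerD2r f g h : f <= g -> f + h <= g + h.
Proof.
by move=> /cfun_leP fg; apply/cfun_leP => i; exact: lerD (fg i) (lexx (h i)).
Qed.

Fact cfun_scaler_ge0 (a : R) f : 0 <= a -> 0 <= f -> 0 <= a *: f.
Proof.
by move=> a0 /cfun_leP f0; apply/cfun_leP => i; exact: mulr_ge0 a0 (f0 i).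
Qed.

HB.instance Definition _ := isVectorLattice.Build R L
  cfun_lexI cfun_leUx cfun_lerD2r cfun_scaler_ge0.

Lemma cfun_meetE f g i : vmeet f g i = Num.min (f i) (g i).
Proof. by rewrite -meetEtotal; exact: meetfE. Qed.

Lemma cfun_joinE f g i : vjoin f g i = Num.max (f i) (g i).
Proof.
rewrite -[f i]opprK -[g i]opprK -oppr_min.
exact: (congr1 -%R (cfun_meetE (- f) (- g) i)).
Qed.

Lemma cfun_vabsE f i : vabs f i = `|f i|.
Proof. by rewrite cfun_joinE maxrN. Qed.

(** The sup norm, as the least nonnegative bound: this form is also correct for
    an empty index set. *)
Definition cfun_norm f : R := inf [set M | 0 <= M /\ forall i, `|f i| <= M].

Lemma cfun_norm_le f M : 0 <= M -> (forall i, `|f i| <= M) -> cfun_norm f <= M.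
Proof. by move=> M0 fM; apply: ge_inf => //; exists 0 => x []. Qed.

Let cfun_bound f : [set M | 0 <= M /\ forall i, `|f i| <= M] !=set0.
Proof.
have [[M fM] _] := cfunP f; exists `|M|; split => // i.
exact: le_trans (fM i) (ler_norm M).
Qed.

Fact cfun_norm_ge0 f : 0 <= cfun_norm f.
Proof. by apply: lb_le_inf (cfun_bound f) _ => M []. Qed.

Lemma cfun_le_norm f i : `|f i| <= cfun_norm f.
Proof. by apply: lb_le_inf (cfun_bound f) _ => M [_]; exact. Qed.

Fact cfun_norm_eq0 f : cfun_norm f = 0 -> f = 0.
Proof.
move=> f0; apply/val_inj/funext => i; apply/eqP; rewrite -normr_le0 -f0.
exact: cfun_le_norm.
Qed.

Let cfun_norm_leZ (a : R) f : cfun_norm (a *: f) <= `|a| * cfun_norm f.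
Proof.
apply: cfun_norm_le => [|i]; first by rewrite mulr_ge0 ?cfun_norm_ge0.
by rewrite [leLHS]normrM ler_wpM2l// cfun_le_norm.
Qed.

Fact cfun_normZ (a : R) f : cfun_norm (a *: f) = `|a| * cfun_norm f.
Proof.
apply/eqP; rewrite eq_le cfun_norm_leZ/=; have [->|a0] := eqVneq a 0.
  by rewrite normr0 mul0r cfun_norm_ge0.
have := cfun_norm_leZ a^-1 (a *: f); rewrite scalerK// normfV.
by rewrite ler_pdivlMl ?normr_gt0.
Qed.

(** A norm is a p-norm because [t `^ p] is subadditive in [t]. *)
Fact cfun_norm_powRD f g :
  cfun_norm (f + g) `^ p <= cfun_norm f `^ p + cfun_norm g `^ p.
Proof.
apply: le_trans (powR_sub hp (cfun_norm_ge0 _) (cfun_norm_ge0 _)).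
apply: ge0_ler_powR; rewrite ?nnegrE ?addr_ge0 ?cfun_norm_ge0 ?(ltW p0)//.
apply: cfun_norm_le => [|i]; first by rewrite addr_ge0 ?cfun_norm_ge0.
by apply: le_trans (ler_normD _ _) _; rewrite lerD ?cfun_le_norm.
Qed.

Fact cfun_le_pnorm f g : vabs f <= vabs g -> cfun_norm f <= cfun_norm g.
Proof.
move=> /cfun_leP fg; apply: cfun_norm_le (cfun_norm_ge0 _) _ => i.
by have := fg i; rewrite !cfun_vabsE => /le_trans; apply; exact: cfun_le_norm.
Qed.

Fact cfun_complete (u : nat -> L) :
  (forall e : R, 0 < e -> exists N : nat, forall m n : nat,
     (N <= m)%N -> (N <= n)%N -> cfun_norm (u m - u n) < e) ->
  exists l : L, cfun_norm (u n - l) @[n --> \oo] --> (0 : R).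
Proof.
move=> uC.
have uE m n i : `|u m i - u n i| <= cfun_norm (u m - u n).
  exact: (cfun_le_norm (u m - u n)).
have cv i : cvgn (fun n => u n i).
  apply: cauchy_cvg; apply/cauchy_exP => e e0; have [N uN] := uC _ e0.
  exists (u N i); exists N => // n /= Nn; rewrite /ball/=.
  by apply: le_lt_trans (uE N n i) _; exact: uN.
pose l i : R := limn (fun n => u n i).
have ul (e : R) : 0 < e -> exists N : nat, forall n, (N <= n)%N ->
    forall i, `|u n i - l i| <= e.
  move=> e0; have e2 : 0 < e / 2 by rewrite divr_gt0.
  have [N uN] := uC _ e2; exists N => n Nn i.
  have /cvgrPdist_lt/(_ _ e2)[M _ hM] := cv i.
  have := hM (maxn N M) (leq_maxr _ _); rewrite /= distrC => lm.
  rewrite (splitr e) -(subrK (u (maxn N M) i) (u n i)) -addrA.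
  apply: le_trans (ler_normD _ _) _; rewrite lerD ?(ltW lm)//.
  by apply: le_trans (uE _ _ _) _; rewrite ltW// uN// leq_maxl.
have lP : S l.
  apply/asboolP/(@cfun_prop_lim _ _ _ _ (fun n => u n : I -> R)).
    by move=> n; exact: cfunP.
  move=> e /ul[N hN].
  by exists N; exact: hN.
exists (Cfun lP); apply/cvgr0Pnorm_le => e e0; have [N hN] := ul e e0.
exists N => // n /= Nn; rewrite ger0_norm ?cfun_norm_ge0//.
by apply: cfun_norm_le (ltW e0) _ => i; exact: hN.
Qed.

HB.instance Definition _ := isPBanachLattice.Build R p L
  cfun_norm_ge0 cfun_norm_eq0 cfun_normZ cfun_norm_powRD cfun_le_pnorm
  cfun_complete.

End cfun_instances.

(** * Necessity of countability *)

(** If [T] is uncountable, choose an infinite sequence [d] and a point [x]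
    outside the countable set formed by the [d n] and the sets [J (d n)].  Then
    [x] is in no [J (d n)], so the finite set [J x] contains every [d n]. *)
Lemma countable_finite_set_map (T : Type) (J : T -> set T) :
  (forall x, finite_set (J x)) ->
  (forall x y, x <> y -> J x y \/ J y x) -> countable [set: T].
Proof.
elim/Ppointed: T J => T J Jfin Jxy; first by rewrite emptyE.
apply: contrapT => ncT.
have /infiniteP/pcard_injP[d /in2TT d_inj] : infinite_set [set: T].
  by move=> /finite_set_countable.
pose U := \bigcup_n (d n |` J (d n)).
have Uc : countable U.
  apply: bigcup_countable => // n _; apply: finite_set_countable.
  by rewrite finite_setU; split.
have [x Ux] : exists x, ~ U x.
  apply: contrapT => /forallNP xU; apply: ncT.
  rewrite (_ : [set: T] = U)//; apply/seteqP; split=> x // _.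
  exact: contrapT (xU x).
have dJ n : J x (d n).
  have [xd|/Jxy[//|Jdx]] := pselect (x = d n); case: Ux; exists n => //.
    by left.
  by right.
apply: infinite_nat; apply: sub_finite_set (finite_preimage _ (Jfin x)).
  by move=> n _; exact: dJ.
by move=> m n _ _; exact: d_inj.
Qed.

Section converse.
Variables (R : realType) (p : R) (hp : 0 < p <= 1) (Gamma : choiceType).
Local Notation L := (ellp hp Gamma).
Local Notation delta := (@ellp_delta R p hp Gamma).

Let p0 : 0 < p. Proof. by have /andP[] := hp. Qed.

(** The elements of l_p(Gamma) vanish at infinity, since [n] coordinates larger
    than [e] force [ppnorm b >= n * e ^ p]. *)
Lemma ellp_finite_level (b : L) (e : R) : 0 < e ->
  finite_set [set g | e < `|b g|].
Proof.
move=> e0; apply: contrapT => inf.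
have ep : 0 < e `^ p by rewrite powR_gt0.
pose n := Num.truncn (ppnorm b / e `^ p).
have [B Bsub nB] := infinite_set_fset n.+1 inf.
have := ellp_sum_le_ppnorm b (fset_uniq B); apply/negP; rewrite -ltNge.
apply: (@lt_le_trans _ _ (e `^ p *+ n.+1)).
  by rewrite -mulr_natl -ltr_pdivrMr// truncnS_gt.
apply: (@le_trans _ _ (e `^ p *+ #|` B|)).
  by rewrite -[leLHS]mulr_natl -[leRHS]mulr_natl ler_wpM2r ?(ltW ep)// ler_nat.
have -> : e `^ p *+ #|` B| = \sum_(g <- B) e `^ p.
  by rewrite big_const_seq count_predT iter_addr_0.
rewrite big_seq [leRHS]big_seq; apply: ler_sum => g gB.
apply: ge0_ler_powR; rewrite ?nnegrE ?(ltW e0) ?(ltW p0)//.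
by apply: ltW; exact: Bsub.
Qed.

(** [None] is the point at infinity of the one-point compactification. *)
Local Notation alpha := (option Gamma).

Definition alpha_cvg : set (alpha * (Gamma -> alpha)) := [set (None, Some)].

(** The convergences of sets with at most two elements in the product space of
    all subsets of Gamma: as [d] goes to infinity, {d} tends to the empty set,
    which is [None], and {g, d} tends to {g}.  Pairs are ordered, hence two
    clauses for the second fact. *)
Definition pairs_cvg :
    set ((alpha + Gamma * Gamma) * (Gamma -> alpha + Gamma * Gamma)) :=
  [set ik | [\/ ik = (inl None, inl \o Some),
     exists g, ik = (inl (Some g), fun d => inr (g, d)) |
     exists g, ik = (inl (Some g), fun d => inr (d, g))]].

Local Notation Z := (cfun hp alpha_cvg).
Local Notation X := (cfun hp pairs_cvg).

Fact restrict_alpha_subproof (f : X) : cfun_pred alpha_cvg hp (f \o inl).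
Proof.
apply/asboolP; have [[M fM] fC] := cfunP f; split.
  by exists M => i; exact: fM.
move=> i k [-> ->] e e0; apply: (fC (inl None) (inl \o Some)) => //.
by constructor 1.
Qed.

Definition restrict_alpha (f : X) : Z := Cfun (restrict_alpha_subproof f).

(** An extension with the same sup norm.  The formula is symmetric in [g] and
    [h], and when [z (Some h)] equals [z None] the value is the sum of the
    maximum and the minimum of [z None] and [z (Some g)] minus [z None], that
    is [z (Some g)].  The simpler [z (Some g) + z (Some h) - z None] has the
    right limits but may increase the norm. *)
Definition extend_pairs_fun (z : alpha -> R) (i : alpha + Gamma * Gamma) : R :=
  match i with
  | inl i => z i
  | inr (g, h) => Num.max (z None) (Num.max (z (Some g)) (z (Some h)))
      + Num.min (z None) (Num.min (z (Some g)) (z (Some h))) - z None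
  end.

Lemma extend_pairs_fun_le (z : alpha -> R) M : (forall i, `|z i| <= M) ->
  forall i, `|extend_pairs_fun z i| <= M.
Proof.
move=> zM [//|[g h]] /=.
have := zM None; have := zM (Some g); have := zM (Some h).
rewrite !ler_norml => /andP[? ?] /andP[? ?] /andP[? ?].
have [?|?] := leP (z (Some g)) (z (Some h));
  have [?|?] := leP (z None) (z (Some h));
  have [?|?] := leP (z None) (z (Some g));
  apply/andP; split; lra.
Qed.

Lemma extend_pairs_fun_dist (z : alpha -> R) g h :
  `|extend_pairs_fun z (inr (g, h)) - z (Some g)| <= `|z (Some h) - z None|.
Proof.
rewrite /=; have := lexx `|z (Some h) - z None|.
rewrite {1}ler_norml => /andP[? ?].
have ? := normr_ge0 (z (Some h) - z None); rewrite ler_norml.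
have [?|?] := leP (z (Some g)) (z (Some h));
  have [?|?] := leP (z None) (z (Some h));
  have [?|?] := leP (z None) (z (Some g));
  apply/andP; split; lra.
Qed.

Lemma extend_pairs_funC (z : alpha -> R) g h :
  extend_pairs_fun z (inr (g, h)) = extend_pairs_fun z (inr (h, g)).
Proof. by rewrite /= (maxC (z (Some g))) (minC (z (Some g))). Qed.

Fact extend_pairs_subproof (z : Z) :
  cfun_pred pairs_cvg hp (extend_pairs_fun z).
Proof.
have [[M zM] zC] := cfunP z; apply/asboolP; split.
  by exists M; exact: extend_pairs_fun_le.
have zfin e : 0 < e -> finite_set [set d | e < `|z (Some d) - z None|].
  by move=> e0; exact: (zC None Some erefl e e0).
move=> _ _ [[-> ->]|[g [-> ->]]|[g [-> ->]]] e e0; first exact: zfin.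
  apply: sub_finite_set (zfin e e0) => d /= /lt_le_trans; apply.
  exact: (extend_pairs_fun_dist z g d).
apply: sub_finite_set (zfin e e0) => d /= /lt_le_trans; apply.
rewrite -/(extend_pairs_fun z (inr (d, g))) extend_pairs_funC.
exact: extend_pairs_fun_dist.
Qed.

Definition extend_pairs (z : Z) : X := Cfun (extend_pairs_subproof z).

Lemma restrict_alpha_hom : lattice_hom restrict_alpha.
Proof.
have rlin : linear restrict_alpha by move=> a f g; apply/val_inj/funext.
split=> //.
- apply: (bounded_continuous rlin (M := 1)) => f; rewrite mul1r.
  by apply: cfun_norm_le (pnorm_ge0 f) _ => i; exact: (cfun_le_norm f).
- move=> f g; apply/val_inj/funext => i.
  by rewrite -[RHS]/((_ : Z) i) cfun_meetE; exact: cfun_meetE.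
- move=> f g; apply/val_inj/funext => i.
  by rewrite -[RHS]/((_ : Z) i) cfun_joinE; exact: cfun_joinE.
Qed.

(** Restriction does not increase norms, and [extend_pairs] is a right inverse
    that does not increase them either. *)
Lemma restrict_alpha_quotient : lattice_quotient restrict_alpha.
Proof.
have re z : restrict_alpha (extend_pairs z) = z by apply/val_inj/funext.
split; first exact: restrict_alpha_hom.
  by move=> z _; exists (extend_pairs z).
move=> z; apply/eqP; rewrite eq_le; apply/andP; split.
  apply: lb_le_inf; first by exists (pnorm (extend_pairs z)), (extend_pairs z).
  move=> _ [f /= <- <-].
  by apply: cfun_norm_le (pnorm_ge0 f) _ => i; exact: (cfun_le_norm f).
apply: (@le_trans _ _ (pnorm (extend_pairs z))).
  apply: ge_inf; first by exists 0 => _ [f _ <-]; exact: pnorm_ge0.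
  by exists (extend_pairs z).
apply: cfun_norm_le (pnorm_ge0 z) _; apply: extend_pairs_fun_le.
exact: (cfun_le_norm z).
Qed.

Fact ellp_to_alpha_subproof (b : L) : cfun_pred alpha_cvg hp (oapp b 0).
Proof.
apply/asboolP; split.
  exists (pnorm b) => -[g|] /=; first exact: ellp_coord_le.
  by rewrite normr0 pnorm_ge0.
move=> i k [-> ->] e e0 /=; apply: sub_finite_set (ellp_finite_level b e0).
by move=> d /=; rewrite subr0.
Qed.

Definition ellp_to_alpha (b : L) : Z := Cfun (ellp_to_alpha_subproof b).

Lemma ellp_to_alpha_hom : lattice_hom ellp_to_alpha.
Proof.
have lin : linear ellp_to_alpha.
  move=> a b c; apply/val_inj/funext => -[g|] //=.
  by suff e : 0 = a * 0 + 0 by []; rewrite mulr0 addr0.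
split=> //.
- apply: (bounded_continuous lin (M := 1)) => b; rewrite mul1r.
  apply: cfun_norm_le (pnorm_ge0 b) _ => -[g|] /=; first exact: ellp_coord_le.
  by rewrite normr0 pnorm_ge0.
- move=> b c; apply/val_inj/funext => -[g|];
    apply/esym/(etrans (cfun_meetE _ _ _)) => /=.
    by rewrite -meetEtotal; exact/esym/meetfE.
  by rewrite minxx.
- move=> b c; apply/val_inj/funext => -[g|];
    apply/esym/(etrans (cfun_joinE _ _ _)) => /=.
    by rewrite -joinEtotal; exact/esym/joinfE.
  by rewrite maxxx.
Qed.

(** A lift of the inclusion provides disjoint functions [f g] equal to 1 at [g].
    At the pair (g, h) the functions [f g] and [f h] cannot both be positive,
    so for one of them the pair is among the finitely many points at which
    continuity does not yet force a value of at least 1/2. *)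
Lemma projective_ellp_countable :
  projective (L : pBanachLatticeType p) -> countable [set: Gamma].
Proof.
move=> [lambda _ projL].
have [S [[linS _ meetS _] rS _]] :=
  projL X Z _ _ restrict_alpha_quotient ellp_to_alpha_hom.
pose f g := S (delta g).
have fg g : f g (inl (Some g)) = 1.
  have -> : f g (inl (Some g)) = (restrict_alpha \o S) (delta g) (Some g) by [].
  by rewrite rS /= eqxx.
have fmin g h i : g != h -> Num.min (f g i) (f h i) = 0.
  move=> gh; rewrite -cfun_meetE -meetS ellp_meet_delta//.
  by rewrite (linear_fun0 linS).
pose J g := [set d | 2^-1 < `|f g (inr (g, d)) - f g (inl (Some g))|] `|`
            [set d | 2^-1 < `|f g (inr (d, g)) - f g (inl (Some g))|].
apply: (@countable_finite_set_map _ J) => [g|g h /eqP gh].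
  have [_ fC] := cfunP (f g); rewrite /J finite_setU.
  split.
    apply: (fC (inl (Some g)) (fun d => inr (g, d))) => //.
    by constructor 2; exists g.
  apply: (fC (inl (Some g)) (fun d => inr (d, g))) => //.
  by constructor 3; exists g.
apply: contrapT => /not_orP[/not_orP[/negP Jg _] /not_orP[_ /negP Jh]].
move: Jg Jh; rewrite /= -!leNgt !fg !ler_norml => /andP[? _] /andP[? _].
(* Both functions are at least 1/2 at the pair (g, h). *)
have := fmin _ _ (inr (g, h)) gh; rewrite /Num.min => {rS linS meetS}.
by case: ltP => _ ?; lra.
Qed.

End converse.

(** * The characterization *)

Theorem theorem6p11 (R : realType) (p : R) (hp : 0 < p <= 1)
    (Gamma : choiceType) :
  projective (ellp hp Gamma : pBanachLatticeType p) <->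
  countable [set: Gamma].
Proof.
split; first exact: projective_ellp_countable.
move=> /countable_enumeration[code [decode [decodeK codeK]]].
exists 2; first by rewrite ler1n.
exact: (ellp_lambda_projective decodeK codeK).
Qed.
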